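(* Let us assume that $\omega\in\mathbf{\Omega}$ satisfies the mild strong non-quasianalyticity condition, that is, $$\int_1^{+\infty}\frac{\ln|\omega(t)|}{t^2}\,\ln\frac{t}{\ln|\omega(t)|}\,dt<+\infty .$$ Then there exists some $\rho\in\mathbf{\Omega}$ satisfying $$|\omega(t)|\le c_0\,|\rho(t)|,\qquad t\in\mathbb{R},$$ with $c_0>0$ a constant, such that the following holds: if $f$ is an entire function and $$|f(z)|\le d_0\,\big|\omega(|z|)^{n_0}\big|,\qquad z\in\mathbb{C},$$ for some integer $n_0\ge1$ and $d_0>0$, then there are constants $c,c'>0$ such that $$\sup_{s\in\mathbb{R},\ |s-t|\le c\ln|\rho(t)|+c'}\ln|f(s)|\ \ge\ -c\,\ln|\rho(t)|-c',\qquad t\in\mathbb{R}.$$ Moreover, if $\omega\in\mathbf{\Omega}_0$, then we can choose $\rho\in\mathbf{\Omega}_0$.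
   Context: $\mathbf{\Omega}$ denotes the set of all entire functions of the form $\omega(z)=\prod_{j=1}^{\infty}\big(1+\frac{iz}{t_j}\big)$, $z\in\mathbb{C}$, where $0<t_1\le t_2\le t_3\le\dots\le+\infty$, $t_1<+\infty$, $\sum_{j\ge1}\frac1{t_j}<+\infty$ (with $\frac{1}{+\infty}=0$). $\mathbf{\Omega}_0$ denotes the set of all entire functions of the same form where moreover $0<t_1\le\frac{t_2}{2}\le\frac{t_3}{3}\le\dots\le+\infty$. $\ln0=-\infty$. The integral in the hypothesis is a well-defined improper integral with value in $(-\infty,+\infty]$.
   Formalization: The entire function f is assumed not identically zero; for f = 0 the growth bound holds but the supremum of ln|f| is −∞, so the stated inequality fails. *)

(* Defs.v *)
From Stdlib Require Import Reals.
From Coquelicot Require Import Coquelicot.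

Set Implicit Arguments.
Open Scope R_scope.

Fixpoint Cprod (a : nat -> C) (n : nat) : C :=
  match n with
  | O => RtoC 1
  | S m => (Cprod a m * a m)%C
  end.

(* Sequences of zeros are indexed from 0, so [t j] is the usual t_(j+1), and
   take values in Rbar to allow +oo.  [Rbar_inv p_infty = 0], hence [recip]
   is the reciprocal with the convention 1/(+oo) = 0. *)
Definition recip (x : Rbar) : R := real (Rbar_inv x).

Definition Omega_seq (t : nat -> Rbar) : Prop :=
  Rbar_lt 0 (t 0%nat) /\
  (forall j, Rbar_le (t j) (t (S j))) /\
  Rbar_lt (t 0%nat) p_infty /\
  ex_series (fun j => recip (t j)).

Definition Omega0_seq (t : nat -> Rbar) : Prop :=
  Omega_seq t /\
  (forall j, Rbar_le (Rbar_div (t j) (INR (S j)))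
                     (Rbar_div (t (S j)) (INR (S (S j))))).

Definition is_Omega_product (t : nat -> Rbar) (w : C -> C) : Prop :=
  forall z : C,
    filterlim (Cprod (fun j => (1 + Ci * z * RtoC (recip (t j)))%C))
              eventually (locally (w z)).

Definition Omega (w : C -> C) : Prop :=
  exists t, Omega_seq t /\ is_Omega_product t w.

Definition Omega0 (w : C -> C) : Prop :=
  exists t, Omega0_seq t /\ is_Omega_product t w.

Definition entire (f : C -> C) : Prop :=
  forall z : C, @ex_derive C_AbsRing C_NormedModule f z.

(* For w in Omega and t real, |w(t)| >= 1, so Stdlib's real-valued [ln], whose
   value at 0 is 0, is the genuine logarithm here; [lnE] is used elsewhere. *)
Definition lnabs (w : C -> C) (t : R) : R := ln (Cmod (w (RtoC t))).

Definition lnE (x : R) : Rbar :=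
  if Rlt_dec 0 x then Finite (ln x) else m_infty.

(* For w in Omega the integrand is continuous on [1, +oo) and positive near
   +oo, so its improper integral always exists in (-oo, +oo]; being < +oo
   is the same as being convergent. *)
Definition mild_strong_nonquasianalytic (w : C -> C) : Prop :=
  ex_RInt_gen (fun t => lnabs w t / t ^ 2 * ln (t / lnabs w t))
              (at_point 1) (Rbar_locally p_infty).

Definition sup_ln_near (f : C -> C) (t r : R) : Rbar :=
  Rbar_lub (fun y => exists s : R,
    Rabs (s - t) <= r /\ y = lnE (Cmod (f (RtoC s)))).

(* f = 0 has to be excluded: it satisfies every growth bound, while
   ln |f| = -oo everywhere. *)
Definition minimum_modulus_majorant (w rho : C -> C) : Prop :=
  (exists c0 : R, 0 < c0 /\
     forall t : R, Cmod (w (RtoC t)) <= c0 * Cmod (rho (RtoC t))) /\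
  (forall f : C -> C,
     entire f ->
     (exists z : C, f z <> RtoC 0) ->
     (exists (n0 : nat) (d0 : R), (1 <= n0)%nat /\ 0 < d0 /\
        forall z : C,
          Cmod (f z) <= d0 * Cmod (Cpow (w (RtoC (Cmod z))) n0)) ->
     exists c c' : R, 0 < c /\ 0 < c' /\
       forall t : R,
         Rbar_le (Finite (- c * lnabs rho t - c'))
                 (sup_ln_near f t (c * lnabs rho t + c'))).

(* Main.v *)
Require Import Defs.
From Stdlib Require Import Reals Lra Lia Psatz Factorial Compare_dec ClassicalEpsilon.
From Coquelicot Require Import Coquelicot.
Open Scope R_scope.

(* The zeros of [rho] are chosen so that [ln |rho(t)|] dominates
   [W(t) ln (1 + t / W(t))], where [W = ln |w|]; this is possible because the
   hypothesis says exactly that [W(t) ln (t / W(t))] is integrable against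
   [dt / t^2].

   If [|f| <= exp (- A)] on a real segment of length [l] at distance [|t|]
   from the origin, interpolate [f] at [m + 1] equispaced points of the
   segment.  By Cauchy's formula the interpolation error at a fixed point [z0]
   is at most [2^(-m)] times the maximum of [|f|] on a disc of radius
   comparable to [|t|], so for [m] comparable to [W(t)] it is below
   [|f(z0)| / 2].  The Lagrange polynomials at [z0] are at most [(C t / l)^m],
   which forces [A <= m ln (C t / l) + O(1)].  Taking [l = W(t)] gives
   [A = O(W(t) ln (1 + t / W(t)) + 1)].

   For [Omega] the zeros of [rho] are the powers of 2, repeated.  For [Omega0]
   the slopes [W(t) / t] are decreasing up to a constant factor, and the
   sequence [h (min_(i <= j) W(i) / i) / j] with [h(x) = x ln (1 + 1 / x)]
   serves as the sequence of reciprocal zeros. *)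


(** The length of the segment is forced. The supremum runs over a window of size O(ln |rho(t)|),
    which is o(t), so a segment of length comparable to t, on which each node would cost only a
    bounded factor, is out of reach. A segment of length W(t) costs a factor C t / W(t) per node,
    and this is the source of the extra logarithm in the hypothesis. The fixed point z0 is taken off
    the real axis, so that its distance to every node is at least |Im z0| whatever t is.

    About W the general case uses only that it is even, nondecreasing on the half-line, o(x) at
    infinity, and satisfies W(k x) <= k^2 W(x) for k >= 1. In [Omega0] the reciprocal zeros must
    have the form h_j / j with h nonincreasing, which repeated zeros violate. There one needs the
    stronger W(n x) <= C n W(x) for integers n, which makes W(x) / x decreasing up to a constant;
    the running minimum then makes it truly decreasing. *)

(** * Complex derivatives in epsilon-delta form *)

Definition has_cderiv (f : C -> C) (z l : C) : Prop :=
  forall eps : R, 0 < eps -> exists delta : R, 0 < delta /\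
    forall u : C, Cmod (u - z)%C < delta ->
      Cmod (f u - f z - l * (u - z))%C <= eps * Cmod (u - z)%C.

Definition ccont (f : C -> C) (z : C) : Prop :=
  forall eps : R, 0 < eps -> exists delta : R, 0 < delta /\
    forall u : C, Cmod (u - z)%C < delta -> Cmod (f u - f z)%C <= eps.

Lemma entire_has_cderiv (f : C -> C) (z : C) :
  entire f -> exists l, has_cderiv f z l.
Proof.
  intros Hf. destruct (Hf z) as [l [_ Hl]]. exists l. intros eps He.
  specialize (Hl z (fun P H => H) (mkposreal eps He)).
  destruct Hl as [d Hd]. exists d. split; [apply cond_pos|].
  intros u Hu. specialize (Hd u Hu). simpl in Hd.
  replace (l * (u - z))%C with ((u - z) * l)%C by ring.
  exact Hd.
Qed.

Lemma Cmod_plus_le (a b : C) (x y : R) :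
  Cmod a <= x -> Cmod b <= y -> Cmod (a + b)%C <= x + y.
Proof. intros. generalize (Cmod_triangle a b). lra. Qed.

Lemma Cmod_minus_sym (a b : C) : Cmod (a - b)%C = Cmod (b - a)%C.
Proof. rewrite <- Cmod_opp. f_equal. ring. Qed.

Lemma Cmod_rev_triangle (a b : C) : Cmod a - Cmod b <= Cmod (a - b)%C.
Proof.
  generalize (Cmod_triangle (a - b) b).
  replace (a - b + b)%C with a by ring. lra.
Qed.

Lemma has_cderiv_lip (f : C -> C) (z l : C) :
  has_cderiv f z l -> exists delta : R, 0 < delta /\
    forall u : C, Cmod (u - z)%C < delta ->
      Cmod (f u - f z)%C <= (Cmod l + 1) * Cmod (u - z)%C.
Proof.
  intros H. destruct (H 1 Rlt_0_1) as [d [Hd K]]. exists d. split; [easy|].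
  intros u Hu. specialize (K u Hu).
  replace (f u - f z)%C with ((f u - f z - l * (u - z)) + l * (u - z))%C by ring.
  eapply Rle_trans; [apply Cmod_triangle|]. rewrite Cmod_mult. lra.
Qed.

Lemma has_cderiv_cont (f : C -> C) (z l : C) : has_cderiv f z l -> ccont f z.
Proof.
  intros H eps He. destruct (has_cderiv_lip _ _ _ H) as [d [Hd K]].
  assert (Hl : 0 < Cmod l + 1) by (generalize (Cmod_ge_0 l); lra).
  exists (Rmin d (eps / (Cmod l + 1))). split.
  { apply Rmin_pos; [easy|]. now apply Rdiv_lt_0_compat. }
  intros u Hu. eapply Rle_trans; [apply K|].
  { eapply Rlt_le_trans; [apply Hu|apply Rmin_l]. }
  assert (Hu' : Cmod (u - z)%C < eps / (Cmod l + 1))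
    by (eapply Rlt_le_trans; [apply Hu|apply Rmin_r]).
  apply Rmult_lt_compat_l with (r := Cmod l + 1) in Hu'; [|easy].
  replace ((Cmod l + 1) * (eps / (Cmod l + 1))) with eps in Hu' by (field; lra).
  lra.
Qed.

Lemma has_cderiv_minus_const (f : C -> C) (z l c : C) :
  has_cderiv f z l -> has_cderiv (fun u => f u - c)%C z l.
Proof.
  intros H eps He. destruct (H eps He) as [d [Hd K]]. exists d. split; [easy|].
  intros u Hu. replace (f u - c - (f z - c) - l * (u - z))%C
    with (f u - f z - l * (u - z))%C by ring. auto.
Qed.

Lemma has_cderiv_const (k z : C) : has_cderiv (fun _ => k) z 0%C.
Proof.
  intros eps He. exists 1. split; [lra|]. intros u _.
  replace (k - k - 0 * (u - z))%C with (RtoC 0) by ring.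
  rewrite Cmod_0. apply Rmult_le_pos; [lra|apply Cmod_ge_0].
Qed.

Lemma has_cderiv_mult (f g : C -> C) (z l m : C) :
  has_cderiv f z l -> has_cderiv g z m ->
  has_cderiv (fun u => f u * g u)%C z (l * g z + f z * m)%C.
Proof.
  intros Hf Hg eps He.
  destruct (has_cderiv_lip _ _ _ Hf) as [d1 [Hd1 K1]].
  set (A := Cmod (g z) + 1). set (B := Cmod (f z) + 1). set (L := Cmod l + 1).
  assert (HA : 0 < A) by (unfold A; generalize (Cmod_ge_0 (g z)); lra).
  assert (HB : 0 < B) by (unfold B; generalize (Cmod_ge_0 (f z)); lra).
  assert (HL : 0 < L) by (unfold L; generalize (Cmod_ge_0 l); lra).
  assert (e1 : 0 < eps / 3 / A) by (apply Rdiv_lt_0_compat; lra).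
  assert (e2 : 0 < eps / 3 / B) by (apply Rdiv_lt_0_compat; lra).
  assert (e3 : 0 < eps / 3 / L) by (apply Rdiv_lt_0_compat; lra).
  destruct (Hf _ e1) as [d2 [Hd2 K2]].
  destruct (Hg _ e2) as [d3 [Hd3 K3]].
  destruct (has_cderiv_cont _ _ _ Hg _ e3) as [d4 [Hd4 K4]].
  exists (Rmin (Rmin d1 d2) (Rmin d3 d4)).
  split; [repeat apply Rmin_pos; easy|].
  intros u Hu.
  apply Rmin_Rgt_l in Hu. destruct Hu as [Hu1 Hu2].
  apply Rmin_Rgt_l in Hu1. apply Rmin_Rgt_l in Hu2.
  destruct Hu1 as [H1 H2]. destruct Hu2 as [H3 H4].
  specialize (K1 u H1). specialize (K2 u H2). specialize (K3 u H3). specialize (K4 u H4).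
  replace (f u * g u - f z * g z - (l * g z + f z * m) * (u - z))%C with
    ((f u - f z - l * (u - z)) * g z + f z * (g u - g z - m * (u - z))
     + (f u - f z) * (g u - g z))%C by ring.
  set (D := Cmod (u - z)%C) in *.
  assert (HD : 0 <= D) by apply Cmod_ge_0.
  eapply Rle_trans; [apply Cmod_triangle|].
  apply Rle_trans with ((eps / 3 * D + eps / 3 * D) + eps / 3 * D); [|lra].
  apply Rplus_le_compat; [apply Cmod_plus_le|]; rewrite Cmod_mult.
  - apply Rle_trans with (eps / 3 / A * D * A).
    + apply Rmult_le_compat; try apply Cmod_ge_0; [easy|unfold A; lra].
    + apply Req_le. field. lra.
  - apply Rle_trans with (B * (eps / 3 / B * D)).
    + apply Rmult_le_compat; try apply Cmod_ge_0; [unfold B; lra|easy].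
    + apply Req_le. field. lra.
  - apply Rle_trans with (L * D * (eps / 3 / L)).
    + apply Rmult_le_compat; try apply Cmod_ge_0; easy.
    + apply Req_le. field. lra.
Qed.

Lemma Cminus_neq_0 (z a : C) : z <> a -> (z - a)%C <> 0%C.
Proof.
  intros H K. apply H. replace z with (z - a + a)%C by ring. rewrite K. ring.
Qed.

Lemma Cmod_minus_pos (z a : C) : z <> a -> 0 < Cmod (z - a)%C.
Proof. intros H. apply Cmod_gt_0. now apply Cminus_neq_0. Qed.

Lemma has_cderiv_inv_minus (z a : C) :
  z <> a -> has_cderiv (fun u => / (u - a))%C z (- / ((z - a) * (z - a)))%C.
Proof.
  intros Hza eps He.
  set (r := Cmod (z - a)%C).
  assert (Hr : 0 < r) by now apply Cmod_minus_pos.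
  exists (Rmin (r / 2) (eps * (r * r * r) / 2)). split.
  { apply Rmin_pos; [lra|]. repeat apply Rmult_lt_0_compat; lra. }
  intros u Hu. apply Rmin_Rgt_l in Hu. destruct Hu as [H1 H2].
  assert (Hua : r / 2 < Cmod (u - a)%C).
  { generalize (Cmod_rev_triangle (z - a) (z - u)).
    replace (z - a - (z - u))%C with (u - a)%C by ring.
    rewrite (Cmod_minus_sym z u). fold r. lra. }
  assert (Hua0 : (u - a)%C <> 0%C) by (apply Cmod_gt_0; lra).
  assert (Hza0 : (z - a)%C <> 0%C) by now apply Cminus_neq_0.
  (* The linearisation error is exactly (u - z)^2 / ((u - a)(z - a)^2), and [delta] keeps |u - a|
     above r/2. *)
  replace (/ (u - a) - / (z - a) - - / ((z - a) * (z - a)) * (u - z))%C with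
    ((u - z) * (u - z) * / ((u - a) * ((z - a) * (z - a))))%C by (field; auto).
  rewrite !Cmod_mult, Cmod_inv by (repeat apply Cmult_neq_0; auto).
  rewrite !Cmod_mult. fold r. set (D := Cmod (u - z)%C) in *.
  set (s := Cmod (u - a)%C) in *.
  assert (HD : 0 <= D) by apply Cmod_ge_0.
  apply Rle_trans with (D * (eps * (r * r * r) / 2) * / (r / 2 * (r * r))).
  - apply Rmult_le_compat.
    + apply Rmult_le_pos; easy.
    + apply Rlt_le, Rinv_0_lt_compat. repeat apply Rmult_lt_0_compat; lra.
    + apply Rmult_le_compat_l; lra.
    + apply Rinv_le_contravar; [repeat apply Rmult_lt_0_compat; lra|].
      apply Rmult_le_compat_r; [apply Rmult_le_pos; lra|lra].
  - apply Req_le. field. lra.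
Qed.

(** * Cauchy's theorem on rectangles *)

Notation is_CRInt := (@is_RInt C_R_NormedModule).
Notation ex_CRInt := (@ex_RInt C_R_NormedModule).
Notation CRInt := (@RInt C_R_CompleteNormedModule).

(** The contour integral over the boundary of [a, b] x [c, d], counterclockwise: bottom minus top,
    plus i times right minus left. *)
Definition rect_int (f : C -> C) (a b c d : R) : C :=
  (CRInt (fun x => f (x, c)) a b - CRInt (fun x => f (x, d)) a b
   + Ci * (CRInt (fun y => f (b, y)) c d - CRInt (fun y => f (a, y)) c d))%C.

(** Continuity is asked on the boundary alone because the Cauchy kernels to be integrated have poles
    inside. *)
Definition ccont_bdry (f : C -> C) (a b c d : R) : Prop :=
  forall x y, a <= x <= b -> c <= y <= d -> x = a \/ x = b \/ y = c \/ y = d ->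
    ccont f (x, y).

Lemma Cmod_le_abs_sum (x y : R) : Cmod (x, y) <= Rabs x + Rabs y.
Proof.
  replace ((x, y) : C) with (RtoC x + Ci * RtoC y)%C.
  - apply Cmod_plus_le; [rewrite Cmod_R; lra|].
    rewrite Cmod_mult, Cmod_Ci, Cmod_R. lra.
  - unfold Ci, RtoC, Cplus, Cmult; simpl. f_equal; ring.
Qed.

Lemma ccont_continuous_path (f : C -> C) (p : R -> C) (x : R) :
  ccont f (p x) -> (forall u, Cmod (p u - p x)%C <= Rabs (u - x)) ->
  @continuous R_UniformSpace C_UniformSpace (fun u => f (p u)) x.
Proof.
  intros H Hp. apply filterlim_locally. intros eps.
  destruct (H (eps / 2)) as [d [Hd K]]; [generalize (cond_pos eps); lra|].
  exists (mkposreal d Hd). intros u Hu.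
  apply C_NormedModule_mixin_compat1.
  change (Cmod (f (p u) - f (p x))%C < eps).
  assert (Cmod (f (p u) - f (p x))%C <= eps / 2).
  { apply K. eapply Rle_lt_trans; [apply Hp|]. exact Hu. }
  generalize (cond_pos eps); lra.
Qed.

Lemma ccont_ex_CRInt_h (f : C -> C) (a b y : R) :
  a <= b -> (forall x, a <= x <= b -> ccont f (x, y)) ->
  ex_CRInt (fun x => f (x, y)) a b.
Proof.
  intros Hab H. apply (@ex_RInt_continuous C_R_CompleteNormedModule).
  rewrite Rmin_left, Rmax_right by easy. intros x Hx.
  apply (ccont_continuous_path f (fun x => (x, y))); [auto|].
  intros u. replace ((u, y) - (x, y))%C with (RtoC (u - x)).
  - rewrite Cmod_R. lra.
  - unfold RtoC, Cminus, Cplus, Copp; simpl. f_equal; ring.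
Qed.

Lemma ccont_ex_CRInt_v (f : C -> C) (x c d : R) :
  c <= d -> (forall y, c <= y <= d -> ccont f (x, y)) ->
  ex_CRInt (fun y => f (x, y)) c d.
Proof.
  intros Hab H. apply (@ex_RInt_continuous C_R_CompleteNormedModule).
  rewrite Rmin_left, Rmax_right by easy. intros y Hy.
  apply (ccont_continuous_path f (fun y => (x, y))); [auto|].
  intros u. replace ((x, u) - (x, y))%C with (Ci * RtoC (u - y))%C.
  - rewrite Cmod_mult, Cmod_Ci, Cmod_R. lra.
  - unfold RtoC, Ci, Cminus, Cplus, Copp, Cmult; simpl. f_equal; ring.
Qed.

Lemma CRInt_Chasles (g : R -> C) (a b c : R) :
  ex_CRInt g a b -> ex_CRInt g b c ->
  CRInt g a c = (CRInt g a b + CRInt g b c)%C.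
Proof.
  intros H1 H2. symmetry.
  apply (@RInt_Chasles C_R_CompleteNormedModule); easy.
Qed.

Lemma rect_int_split_h (f : C -> C) (a m b c d : R) :
  a <= m <= b -> (forall x, a <= x <= b -> ccont f (x, c) /\ ccont f (x, d)) ->
  rect_int f a b c d = (rect_int f a m c d + rect_int f m b c d)%C.
Proof.
  intros Hm H. unfold rect_int.
  rewrite (CRInt_Chasles (fun x => f (x, c)) a m b), (CRInt_Chasles (fun x => f (x, d)) a m b).
  - ring.
  - apply ccont_ex_CRInt_h; [lra|intros; apply H; lra].
  - apply ccont_ex_CRInt_h; [lra|intros; apply H; lra].
  - apply ccont_ex_CRInt_h; [lra|intros; apply H; lra].
  - apply ccont_ex_CRInt_h; [lra|intros; apply H; lra].
Qed.

Lemma rect_int_split_v (f : C -> C) (a b c m d : R) :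
  c <= m <= d -> (forall y, c <= y <= d -> ccont f (a, y) /\ ccont f (b, y)) ->
  rect_int f a b c d = (rect_int f a b c m + rect_int f a b m d)%C.
Proof.
  intros Hm H. unfold rect_int.
  rewrite (CRInt_Chasles (fun y => f (a, y)) c m d), (CRInt_Chasles (fun y => f (b, y)) c m d).
  - ring.
  - apply ccont_ex_CRInt_v; [lra|intros; apply H; lra].
  - apply ccont_ex_CRInt_v; [lra|intros; apply H; lra].
  - apply ccont_ex_CRInt_v; [lra|intros; apply H; lra].
  - apply ccont_ex_CRInt_v; [lra|intros; apply H; lra].
Qed.

Lemma CRInt_bound (g : R -> C) (a b M : R) :
  a <= b -> ex_CRInt g a b -> (forall x, a <= x <= b -> Cmod (g x) <= M) ->
  Cmod (CRInt g a b) <= (b - a) * M.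
Proof.
  intros Hab Hex HM.
  (* The norm of the real module C is the product norm, with absolute values of the components under
     the square root; it equals [Cmod], but not by conversion. *)
  assert (E : forall z : C, Cmod z = @norm R_AbsRing C_R_NormedModule z).
  { intros z. apply (f_equal sqrt).
    apply f_equal2; rewrite <- !Rsqr_pow2; apply Rsqr_abs. }
  rewrite E. apply (@norm_RInt_le_const C_R_NormedModule g a b).
  - easy.
  - intros x Hx. rewrite <- E. auto.
  - now apply (@RInt_correct C_R_CompleteNormedModule).
Qed.

Lemma rect_int_bound (f : C -> C) (a b c d M : R) :
  a <= b -> c <= d -> ccont_bdry f a b c d ->
  (forall x y, a <= x <= b -> c <= y <= d -> (x = a \/ x = b \/ y = c \/ y = d) ->
     Cmod (f (x, y)) <= M) ->
  Cmod (rect_int f a b c d) <= 2 * ((b - a) + (d - c)) * M.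
Proof.
  intros Hab Hcd Hc HM. unfold rect_int.
  replace (2 * ((b - a) + (d - c)) * M) with
    (((b - a) * M + (b - a) * M) + ((d - c) * M + (d - c) * M)) by ring.
  apply Cmod_plus_le; [|rewrite Cmod_mult, Cmod_Ci, Rmult_1_l];
    (apply Cmod_plus_le; [|rewrite Cmod_opp]); (apply CRInt_bound; [assumption| |]).
  1, 3: apply ccont_ex_CRInt_h; [assumption|intros; apply Hc; auto; lra].
  3, 5: apply ccont_ex_CRInt_v; [assumption|intros; apply Hc; auto; lra].
  all: intros; apply HM; auto; lra.
Qed.


Lemma ccont_plus (f g : C -> C) (z : C) :
  ccont f z -> ccont g z -> ccont (fun u => f u + g u)%C z.
Proof.
  intros Hf Hg eps He.
  destruct (Hf (eps / 2)) as [d1 [Hd1 K1]]; [lra|].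
  destruct (Hg (eps / 2)) as [d2 [Hd2 K2]]; [lra|].
  exists (Rmin d1 d2). split; [now apply Rmin_pos|].
  intros u Hu. apply Rmin_Rgt_l in Hu. destruct Hu as [H1 H2].
  replace (f u + g u - (f z + g z))%C with ((f u - f z) + (g u - g z))%C by ring.
  replace eps with (eps / 2 + eps / 2) by field.
  apply Cmod_plus_le; auto.
Qed.

Lemma ccont_affine (p q z0 z : C) : ccont (fun u => p + q * (u - z0))%C z.
Proof.
  apply has_cderiv_cont with q. intros eps He. exists 1. split; [lra|].
  intros u _. replace (p + q * (u - z0) - (p + q * (z - z0)) - q * (u - z))%C
    with (RtoC 0) by ring.
  rewrite Cmod_0. apply Rmult_le_pos; [lra|apply Cmod_ge_0].
Qed.

Lemma CRInt_plus (g h : R -> C) (a b : R) :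
  ex_CRInt g a b -> ex_CRInt h a b ->
  CRInt (fun x => g x + h x)%C a b = (CRInt g a b + CRInt h a b)%C.
Proof. intros. now apply (@RInt_plus C_R_CompleteNormedModule). Qed.

Lemma is_CRInt_pair (g : R -> C) (a b u v : R) :
  is_RInt (fun x => fst (g x)) a b u -> is_RInt (fun x => snd (g x)) a b v ->
  is_CRInt g a b (u, v).
Proof. intros. now apply (@is_RInt_fct_extend_pair R_NormedModule R_NormedModule). Qed.

(** The integral lives in a module over the reals, so a complex factor is treated through real and
    imaginary parts. *)
Lemma CRInt_scal (k : C) (g : R -> C) (a b : R) :
  ex_CRInt g a b -> CRInt (fun x => k * g x)%C a b = (k * CRInt g a b)%C.
Proof.
  intros H. apply (@is_RInt_unique C_R_CompleteNormedModule).
  apply (@RInt_correct C_R_CompleteNormedModule) in H.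
  set (I := CRInt g a b) in *.
  assert (H1 := @is_RInt_fct_extend_fst R_NormedModule R_NormedModule g a b I H).
  assert (H2 := @is_RInt_fct_extend_snd R_NormedModule R_NormedModule g a b I H).
  destruct k as [k1 k2].
  apply is_CRInt_pair; simpl.
  - apply (@is_RInt_minus R_NormedModule); now apply (@is_RInt_scal R_NormedModule).
  - apply (@is_RInt_plus R_NormedModule); now apply (@is_RInt_scal R_NormedModule).
Qed.

Lemma rect_int_plus (f g : C -> C) (a b c d : R) :
  a <= b -> c <= d -> ccont_bdry f a b c d -> ccont_bdry g a b c d ->
  rect_int (fun z => f z + g z)%C a b c d
  = (rect_int f a b c d + rect_int g a b c d)%C.
Proof.
  intros Hab Hcd Hf Hg. unfold rect_int.
  rewrite (CRInt_plus (fun x => f (x, c)) (fun x => g (x, c))).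
  rewrite (CRInt_plus (fun x => f (x, d)) (fun x => g (x, d))).
  rewrite (CRInt_plus (fun x => f (a, x)) (fun x => g (a, x))).
  rewrite (CRInt_plus (fun x => f (b, x)) (fun x => g (b, x))).
  ring.
  all: match goal with
    | |- ex_CRInt (fun x => ?f (x, _)) _ _ => apply ccont_ex_CRInt_h; [easy|]
    | |- ex_CRInt (fun x => ?f (_, x)) _ _ => apply ccont_ex_CRInt_v; [easy|]
    end.
  all: intros; (apply Hf || apply Hg); auto; lra.
Qed.

Lemma rect_int_scal (k : C) (f : C -> C) (a b c d : R) :
  a <= b -> c <= d -> ccont_bdry f a b c d ->
  rect_int (fun z => k * f z)%C a b c d = (k * rect_int f a b c d)%C.
Proof.
  intros Hab Hcd Hf. unfold rect_int.
  rewrite (CRInt_scal k (fun x => f (x, c))).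
  rewrite (CRInt_scal k (fun x => f (x, d))).
  rewrite (CRInt_scal k (fun x => f (a, x))).
  rewrite (CRInt_scal k (fun x => f (b, x))).
  ring.
  all: match goal with
    | |- ex_CRInt (fun x => ?f (x, _)) _ _ => apply ccont_ex_CRInt_h; [easy|]
    | |- ex_CRInt (fun x => ?f (_, x)) _ _ => apply ccont_ex_CRInt_v; [easy|]
    end.
  all: intros; apply Hf; auto; lra.
Qed.

Lemma CRInt_ext (g h : R -> C) (a b : R) :
  a <= b -> (forall x, a <= x <= b -> g x = h x) -> CRInt g a b = CRInt h a b.
Proof.
  intros Hab H. apply (@RInt_ext C_R_CompleteNormedModule).
  rewrite Rmin_left, Rmax_right by easy. intros; apply H; lra.
Qed.

Lemma rect_int_ext (f g : C -> C) (a b c d : R) :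
  a <= b -> c <= d ->
  (forall x y, a <= x <= b -> c <= y <= d -> (x = a \/ x = b \/ y = c \/ y = d) ->
     f (x, y) = g (x, y)) ->
  rect_int f a b c d = rect_int g a b c d.
Proof.
  intros Hab Hcd H. unfold rect_int.
  rewrite (CRInt_ext (fun x => f (x, c)) (fun x => g (x, c))).
  rewrite (CRInt_ext (fun x => f (x, d)) (fun x => g (x, d))).
  rewrite (CRInt_ext (fun x => f (a, x)) (fun x => g (a, x))).
  rewrite (CRInt_ext (fun x => f (b, x)) (fun x => g (b, x))).
  all: try easy; intros; apply H; auto; lra.
Qed.

(** This is what lets the tangent be subtracted in Goursat's argument. The primitives are written
    out for each component on each side. *)
Lemma rect_int_affine (p q z0 : C) (a b c d : R) :
  rect_int (fun u => p + q * (u - z0))%C a b c d = 0%C.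
Proof.
  destruct p as [p1 p2]. destruct q as [q1 q2]. destruct z0 as [x0 y0].
  assert (Hh : forall y, CRInt (fun x => (p1, p2) + (q1, q2) * ((x, y) - (x0, y0)))%C a b
    = ((p1 - q1 * x0 - q2 * (y - y0)) * (b - a) + q1 * (b * b - a * a) / 2,
       (p2 + q1 * (y - y0) - q2 * x0) * (b - a) + q2 * (b * b - a * a) / 2)).
  { intros y. apply (@is_RInt_unique C_R_CompleteNormedModule). apply is_CRInt_pair; simpl.
    - evar_last. apply (is_RInt_derive (fun x => (p1 - q1 * x0 - q2 * (y - y0)) * x + q1 * (x * x) / 2)).
      + intros x _. auto_derive; [easy|]. field.
      + intros x _. apply (ex_derive_continuous (fun x => _ + _)). auto_derive. easy.
      + simpl. unfold minus, plus, opp; simpl. field.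
    - evar_last. apply (is_RInt_derive (fun x => (p2 + q1 * (y - y0) - q2 * x0) * x + q2 * (x * x) / 2)).
      + intros x _. auto_derive; [easy|]. field.
      + intros x _. apply (ex_derive_continuous (fun x => _ + _)). auto_derive. easy.
      + simpl. unfold minus, plus, opp; simpl. field. }
  assert (Hv : forall x, CRInt (fun y => (p1, p2) + (q1, q2) * ((x, y) - (x0, y0)))%C c d
    = ((p1 + q1 * (x - x0) + q2 * y0) * (d - c) - q2 * (d * d - c * c) / 2,
       (p2 + q2 * (x - x0) - q1 * y0) * (d - c) + q1 * (d * d - c * c) / 2)).
  { intros x. apply (@is_RInt_unique C_R_CompleteNormedModule). apply is_CRInt_pair; simpl.
    - evar_last. apply (is_RInt_derive (fun y => (p1 + q1 * (x - x0) + q2 * y0) * y - q2 * (y * y) / 2)).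
      + intros y _. auto_derive; [easy|]. field.
      + intros y _. apply (ex_derive_continuous (fun x => _ + _)). auto_derive. easy.
      + simpl. unfold minus, plus, opp; simpl. field.
    - evar_last. apply (is_RInt_derive (fun y => (p2 + q2 * (x - x0) - q1 * y0) * y + q1 * (y * y) / 2)).
      + intros y _. auto_derive; [easy|]. field.
      + intros y _. apply (ex_derive_continuous (fun x => _ + _)). auto_derive. easy.
      + simpl. unfold minus, plus, opp; simpl. field. }
  unfold rect_int. rewrite !Hh, !Hv.
  unfold Ci, RtoC, Cminus, Cplus, Copp, Cmult; simpl. f_equal; field.
Qed.

Lemma nested_intervals (u v : nat -> R) :
  (forall n, u n <= u (S n)) -> (forall n, v (S n) <= v n) -> (forall n, u n <= v n) ->
  exists x, forall n, u n <= x <= v n.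
Proof.
  intros Hu Hv Huv.
  assert (Hu' : forall n k, u n <= u (n + k)%nat).
  { intros n k. induction k; [rewrite Nat.add_0_r; lra|].
    rewrite Nat.add_succ_r. eapply Rle_trans; [apply IHk|apply Hu]. }
  assert (Hv' : forall n k, v (n + k)%nat <= v n).
  { intros n k. induction k; [rewrite Nat.add_0_r; lra|].
    rewrite Nat.add_succ_r. eapply Rle_trans; [apply Hv|apply IHk]. }
  destruct (completeness (fun y => exists n, y = u n)) as [x [H1 H2]].
  - exists (v O). intros y [n ->]. eapply Rle_trans; [apply Huv|]. apply (Hv' O n).
  - now exists (u O), O.
  - exists x. intros n. split; [apply H1; now exists n|].
    apply H2. intros y [k ->].
    apply Rle_trans with (u (k + n)%nat); [apply Hu'|].
    eapply Rle_trans; [apply Huv|]. rewrite Nat.add_comm. apply Hv'.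
Qed.

Lemma pow2_inv_small (A eps : R) : 0 <= A -> 0 < eps -> exists n : nat, A / 2 ^ n < eps.
Proof.
  intros HA He.
  destruct (Pow_x_infinity 2) with (b := A / eps + 1) as [n Hn].
  { rewrite Rabs_pos_eq; lra. }
  exists n. specialize (Hn n (Nat.le_refl n)).
  assert (P : 0 < 2 ^ n) by (apply pow_lt; lra).
  rewrite Rabs_pos_eq in Hn by lra.
  apply Rmult_lt_reg_r with (2 ^ n); [easy|].
  replace (A / 2 ^ n * 2 ^ n) with A by (field; lra).
  apply Rmult_ge_compat_l with (r := eps) in Hn; [|lra].
  replace (eps * (A / eps + 1)) with (A + eps) in Hn by (field; lra). lra.
Qed.

(** Goursat's bisection: one of the four quarters carries at least a quarter of the integral in
    modulus. The nested quarters shrink to a point where [f] is affine up to an error small against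
    the diameter, while perimeter times diameter decreases like 4^(-n). *)
Lemma goursat (f : C -> C) (a b c d : R) :
  a <= b -> c <= d ->
  (forall x y, a <= x <= b -> c <= y <= d -> exists l, has_cderiv f (x, y) l) ->
  rect_int f a b c d = 0%C.
Proof.
  intros Hab Hcd Hf.
  assert (Hc : forall x y, a <= x <= b -> c <= y <= d -> ccont f (x, y)).
  { intros x y Hx Hy. destruct (Hf x y Hx Hy) as [l Hl]. now apply has_cderiv_cont with l. }
  set (w := b - a). set (h := d - c).
  assert (Hw : 0 <= w) by (unfold w; lra). assert (Hh : 0 <= h) by (unfold h; lra).
  set (I := fun (n : nat) (p : R * R) =>
    Cmod (rect_int f (fst p) (fst p + w / 2 ^ n) (snd p) (snd p + h / 2 ^ n))).
  set (inv := fun (n : nat) (p : R * R) =>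
    (a <= fst p /\ fst p + w / 2 ^ n <= b) /\ (c <= snd p /\ snd p + h / 2 ^ n <= d)).
  assert (Hpow : forall n, 0 < 2 ^ n) by (intros; apply pow_lt; lra).
  assert (Hwn : forall n, 0 <= w / 2 ^ n)
    by (intros; apply Rmult_le_pos; [easy|apply Rlt_le, Rinv_0_lt_compat, Hpow]).
  assert (Hhn : forall n, 0 <= h / 2 ^ n)
    by (intros; apply Rmult_le_pos; [easy|apply Rlt_le, Rinv_0_lt_compat, Hpow]).
  assert (Hw2 : forall n, w / 2 ^ n = w / 2 ^ S n + w / 2 ^ S n).
  { intros n. simpl. specialize (Hpow n). field. lra. }
  assert (Hh2 : forall n, h / 2 ^ n = h / 2 ^ S n + h / 2 ^ S n).
  { intros n. simpl. specialize (Hpow n). field. lra. }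
  (* The invariant is a premise inside the existential, so that choice yields a step function
     defined on every corner. *)
  assert (Hstep : forall (n : nat) (p : R * R), exists p' : R * R, inv n p ->
    (inv (S n) p' /\ I n p <= 4 * I (S n) p') /\
    (fst p <= fst p' /\ fst p' + w / 2 ^ S n <= fst p + w / 2 ^ n) /\
    (snd p <= snd p' /\ snd p' + h / 2 ^ S n <= snd p + h / 2 ^ n)).
  { intros n [x y]. unfold inv, I; simpl fst; simpl snd.
    destruct (classic ((a <= x /\ x + w / 2 ^ n <= b) /\ (c <= y /\ y + h / 2 ^ n <= d)))
      as [Hi|Hi]; [|exists (0, 0); tauto].
    destruct Hi as [Hi1 Hi2].
    rewrite (Hw2 n), (Hh2 n) in *.
    specialize (Hwn (S n)). specialize (Hhn (S n)).
    set (w' := w / 2 ^ S n) in *. set (h' := h / 2 ^ S n) in *.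
    assert (E : rect_int f x (x + (w' + w')) y (y + (h' + h')) =
      ((rect_int f x (x + w') y (y + h')
       + rect_int f x (x + w') (y + h') (y + h' + h'))
      + (rect_int f (x + w') (x + w' + w') y (y + h')
       + rect_int f (x + w') (x + w' + w') (y + h') (y + h' + h')))%C).
    { replace (x + (w' + w')) with (x + w' + w') by ring.
      replace (y + (h' + h')) with (y + h' + h') by ring.
      rewrite (rect_int_split_h f x (x + w') (x + w' + w')); [|lra|].
      2: intros u Hu; split; apply Hc; lra.
      f_equal; (apply rect_int_split_v; [lra|]).
      all: intros v Hv; split; apply Hc; lra. }
    set (r1 := rect_int f x (x + w') y (y + h')) in *.
    set (r2 := rect_int f x (x + w') (y + h') (y + h' + h')) in *.
    set (r3 := rect_int f (x + w') (x + w' + w') y (y + h')) in *.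
    set (r4 := rect_int f (x + w') (x + w' + w') (y + h') (y + h' + h')) in *.
    rewrite E. set (T := Cmod ((r1 + r2) + (r3 + r4))%C).
    assert (HT : T <= (Cmod r1 + Cmod r2) + (Cmod r3 + Cmod r4)).
    { apply Cmod_plus_le; apply Cmod_triangle. }
    destruct (Rle_dec T (4 * Cmod r1)); [exists (x, y); simpl; fold r1; intros _; lra|].
    destruct (Rle_dec T (4 * Cmod r2)); [exists (x, y + h'); simpl; fold r2; intros _; lra|].
    destruct (Rle_dec T (4 * Cmod r3)); [exists (x + w', y); simpl; fold r3; intros _; lra|].
    exists (x + w', y + h'); simpl; fold r4; intros _; lra. }
  set (next := fun n p => proj1_sig (constructive_indefinite_description _ (Hstep n p))).
  set (s := fix s (n : nat) : R * R := match n with O => (a, c) | S n => next n (s n) end).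
  assert (Hs : forall n, inv n (s n)).
  { induction n.
    - unfold inv; simpl. unfold w, h. lra.
    - simpl. unfold next. destruct (constructive_indefinite_description _ _) as [p' Hp']. simpl.
      apply Hp', IHn. }
  assert (Hs' : forall n, I n (s n) <= 4 * I (S n) (s (S n)) /\
    (fst (s n) <= fst (s (S n)) /\ fst (s (S n)) + w / 2 ^ S n <= fst (s n) + w / 2 ^ n) /\
    (snd (s n) <= snd (s (S n)) /\ snd (s (S n)) + h / 2 ^ S n <= snd (s n) + h / 2 ^ n)).
  { intros n. change (s (S n)) with (next n (s n)). unfold next.
    destruct (constructive_indefinite_description _ _) as [p' Hp']. cbn [proj1_sig].
    specialize (Hp' (Hs n)). tauto. }
  assert (HI : forall n, I O (s O) <= 4 ^ n * I n (s n)).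
  { induction n; [simpl; lra|]. eapply Rle_trans; [apply IHn|].
    change (4 ^ S n) with (4 * 4 ^ n). destruct (Hs' n) as [K _].
    apply Rmult_le_compat_l with (r := 4 ^ n) in K; [lra|]. apply pow_le; lra. }
  destruct (nested_intervals (fun n => fst (s n)) (fun n => fst (s n) + w / 2 ^ n)) as [x Hx].
  { apply Hs'. } { apply Hs'. } { intros n. specialize (Hwn n). lra. }
  destruct (nested_intervals (fun n => snd (s n)) (fun n => snd (s n) + h / 2 ^ n)) as [y Hy].
  { apply Hs'. } { apply Hs'. } { intros n. specialize (Hhn n). lra. }
  destruct (Hf x y) as [l Hl].
  { specialize (Hx O); specialize (Hs O); unfold inv in Hs; lra. }
  { specialize (Hy O); specialize (Hs O); unfold inv in Hs; lra. }
  apply Cmod_eq_0.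
  replace (rect_int f a b c d) with
    (rect_int f (fst (s O)) (fst (s O) + w / 2 ^ 0) (snd (s O)) (snd (s O) + h / 2 ^ 0))
    by (simpl; unfold w, h; f_equal; lra).
  fold (I O (s O)).
  apply Rle_antisym; [|apply Cmod_ge_0].
  apply le_epsilon. intros eps He. rewrite Rplus_0_l.
  (* On the n-th rectangle the perimeter is 2(w + h)/2^n and the error per point eps/K times (w +
     h)/2^n. After the factor 4^n there remains eps (K - 1)/K; the summand 1 keeps [K] positive for
     degenerate rectangles. *)
  set (K := 2 * ((w + h) * (w + h)) + 1).
  assert (HK : 0 < K) by (unfold K; nra).
  destruct (Hl (eps / K)) as [dl [Hdl Hd]]; [now apply Rdiv_lt_0_compat|].
  destruct (pow2_inv_small (w + h) dl) as [n Hn]; [lra|easy|].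
  eapply Rle_trans; [apply (HI n)|].
  set (p := s n) in *. specialize (Hx n). specialize (Hy n). specialize (Hs n).
  specialize (Hwn n). specialize (Hhn n). fold p in Hx, Hy, Hs. unfold inv in Hs.
  assert (Hloc : ccont_bdry f (fst p) (fst p + w / 2 ^ n) (snd p) (snd p + h / 2 ^ n)).
  { intros u v Hu Hv _. apply Hc; lra. }
  assert (E : I n p <= 2 * (w / 2 ^ n + h / 2 ^ n) * (eps / K * (w / 2 ^ n + h / 2 ^ n))).
  { unfold I.
    (* Subtracting the tangent at the limit point does not change the integral. *)
    replace (rect_int f (fst p) (fst p + w / 2 ^ n) (snd p) (snd p + h / 2 ^ n)) with
      (rect_int (fun z => f z + (- f (x, y) + (- l) * (z - (x, y))))%C
        (fst p) (fst p + w / 2 ^ n) (snd p) (snd p + h / 2 ^ n)).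
    2: { rewrite rect_int_plus; [|lra|lra|easy|].
         - rewrite rect_int_affine. ring.
         - intros u v _ _ _. apply ccont_affine. }
    eapply Rle_trans; [apply rect_int_bound with (M := eps / K * (w / 2 ^ n + h / 2 ^ n))|].
    - lra.
    - lra.
    - intros u v Hu Hv B. apply ccont_plus; [now apply Hloc|apply ccont_affine].
    - intros u v Hu Hv _.
      replace (f (u, v) + (- f (x, y) + - l * ((u, v) - (x, y))))%C with
        (f (u, v) - f (x, y) - l * ((u, v) - (x, y)))%C by ring.
      assert (D : Cmod ((u, v) - (x, y))%C <= w / 2 ^ n + h / 2 ^ n).
      { eapply Rle_trans; [apply (Cmod_le_abs_sum (u + - x) (v + - y))|].
        apply Rplus_le_compat; apply Rabs_le; lra. }
      eapply Rle_trans.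
      + apply Hd. eapply Rle_lt_trans; [apply D|].
        unfold Rdiv in *. rewrite <- Rmult_plus_distr_r. easy.
      + apply Rmult_le_compat_l; [|easy]. apply Rlt_le. now apply Rdiv_lt_0_compat.
    - right. ring. }
  apply Rmult_le_compat_l with (r := 4 ^ n) in E; [|apply pow_le; lra].
  eapply Rle_trans; [apply E|].
  replace (4 ^ n) with (2 ^ n * 2 ^ n) by (rewrite <- Rpow_mult_distr; f_equal; lra).
  replace (2 ^ n * 2 ^ n * (2 * (w / 2 ^ n + h / 2 ^ n) * (eps / K * (w / 2 ^ n + h / 2 ^ n))))
    with (eps * ((K - 1) / K)) by (unfold K; specialize (Hpow n); field; unfold K in HK; lra).
  rewrite <- (Rmult_1_r eps) at 2. apply Rmult_le_compat_l; [lra|].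
  apply Rmult_le_reg_r with K; [easy|]. replace ((K - 1) / K * K) with (K - 1) by (field; lra). lra.
Qed.


(** * Cauchy's integral formula on rectangles *)

(** The two rectangles differ by four strips that avoid the singular point, and [goursat] applies to
    each strip. *)
Lemma rect_int_shrink (g : C -> C) (p q a b c d a1 b1 c1 d1 : R) :
  a <= a1 -> a1 < p -> p < b1 -> b1 <= b -> c <= c1 -> c1 < q -> q < d1 -> d1 <= d ->
  (forall z : C, z <> (p, q) -> exists l, has_cderiv g z l) ->
  rect_int g a b c d = rect_int g a1 b1 c1 d1.
Proof.
  intros Ha Ha1 Hb1 Hb Hc Hc1 Hd1 Hd Hg.
  assert (Hcont : forall x y, x <> p \/ y <> q -> ccont g (x, y)).
  { intros x y Hxy. destruct (Hg (x, y)) as [l Hl].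
    - intros E. injection E. intros. destruct Hxy; auto.
    - now apply has_cderiv_cont with l. }
  assert (Hz : forall a b c d, a <= b -> c <= d -> (forall x y, a <= x <= b -> c <= y <= d ->
    x <> p \/ y <> q) -> rect_int g a b c d = 0%C).
  { intros a' b' c' d' Hab Hcd H. apply goursat; try easy. intros x y Hx Hy. apply Hg.
    intros E. injection E. intros. destruct (H x y Hx Hy); auto. }
  rewrite (rect_int_split_h g a a1 b); [|lra|intros; split; apply Hcont; right; lra].
  rewrite (Hz a a1 c d); [|lra|lra|intros; left; lra].
  rewrite (rect_int_split_h g a1 b1 b); [|lra|intros; split; apply Hcont; right; lra].
  rewrite (Hz b1 b c d); [|lra|lra|intros; left; lra].
  rewrite (rect_int_split_v g a1 b1 c c1 d); [|lra|intros; split; apply Hcont; left; lra].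
  rewrite (Hz a1 b1 c c1); [|lra|lra|intros; right; lra].
  rewrite (rect_int_split_v g a1 b1 c1 d1 d); [|lra|intros; split; apply Hcont; left; lra].
  rewrite (Hz a1 b1 d1 d); [|lra|lra|intros; right; lra].
  ring.
Qed.

Lemma Cpair_minus (x y u v : R) : ((x, y) - (u, v))%C = (x - u, y - v).
Proof. reflexivity. Qed.

Lemma pos_lower_bound4 (p q r s : R) :
  0 < p -> 0 < q -> 0 < r -> 0 < s ->
  exists e, 0 < e /\ (e <= p /\ e <= q) /\ e <= r /\ e <= s.
Proof.
  intros. exists (Rmin (Rmin p q) (Rmin r s)). split; [repeat apply Rmin_pos; easy|].
  generalize (Rmin_l (Rmin p q) (Rmin r s)) (Rmin_r (Rmin p q) (Rmin r s))
    (Rmin_l p q) (Rmin_r p q) (Rmin_l r s) (Rmin_r r s). lra.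
Qed.

(** Near the point the difference quotient is bounded by |l| + 1, so its integral over a small
    square is at most a constant times the side. The value at the point itself never enters, only
    boundaries are integrated over. *)
Lemma rect_int_removable (f : C -> C) (p q a b c d : R) :
  a < p < b -> c < q < d -> (forall z, exists l, has_cderiv f z l) ->
  rect_int (fun z => (f z - f (p, q)) * / (z - (p, q)))%C a b c d = 0%C.
Proof.
  intros Hp Hq Hf. set (z0 := (p, q) : C).
  destruct (Hf z0) as [l Hl]. destruct (has_cderiv_lip _ _ _ Hl) as [dl [Hdl Hd]].
  apply Cmod_eq_0. apply Rle_antisym; [|apply Cmod_ge_0].
  apply le_epsilon. intros eps He. rewrite Rplus_0_l.
  set (L := Cmod l + 1). assert (HL : 0 < L) by (unfold L; generalize (Cmod_ge_0 l); lra).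
  destruct (pos_lower_bound4 (p - a) (b - p) (q - c) (d - q)) as [e1 [He1 H1]]; try lra.
  assert (Hq1 : 0 < eps / (8 * L)) by (apply Rdiv_lt_0_compat; lra).
  (* Boundary points satisfy |x - p| + |y - q| <= 2e < [dl], where the Lipschitz bound holds; the
     perimeter 8e times [L] is at most eps. *)
  destruct (pos_lower_bound4 e1 e1 (dl / 3) (eps / (8 * L))) as [e [He0 H2]]; try lra.
  assert (Hg : forall z : C, z <> z0 ->
    exists m, has_cderiv (fun z => (f z - f z0) * / (z - z0))%C z m).
  { intros z Hz. destruct (Hf z) as [lz Hlz]. eexists. apply has_cderiv_mult.
    - apply has_cderiv_minus_const. apply Hlz.
    - now apply has_cderiv_inv_minus. }
  rewrite (rect_int_shrink _ p q a b c d (p - e) (p + e) (q - e) (q + e)); try lra; [|easy].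
  eapply Rle_trans; [apply rect_int_bound with (M := L)|].
  - lra.
  - lra.
  - intros x y Hx Hy B. destruct (Hg (x, y)) as [m Hm]; [|now apply has_cderiv_cont with m].
    intros E. injection E. intros. lra.
  - intros x y Hx Hy B.
    assert (N : ((x, y) : C) <> z0) by (intros E; injection E; intros; lra).
    rewrite Cmod_mult, Cmod_inv by now apply Cminus_neq_0.
    generalize (Cmod_minus_pos _ _ N). intros P.
    apply Rmult_le_reg_r with (Cmod ((x, y) - z0)%C); [easy|].
    rewrite Rmult_assoc, Rinv_l by lra. rewrite Rmult_1_r.
    apply Hd. unfold z0. rewrite Cpair_minus. eapply Rle_lt_trans; [apply Cmod_le_abs_sum|].
    assert (Rabs (x - p) <= e) by (apply Rabs_le; lra).
    assert (Rabs (y - q) <= e) by (apply Rabs_le; lra). lra.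
  - replace (p + e - (p - e) + (q + e - (q - e))) with (4 * e) by ring.
    destruct H2 as [_ [_ H]].
    apply Rmult_le_compat_r with (r := 8 * L) in H; [|lra].
    replace (eps / (8 * L) * (8 * L)) with eps in H by (field; lra). lra.
Qed.

(** On each side of a square of half-side e centred at (p, q), the kernel 1/(z - (p, q)) is one of
    1, -1, i, -i times this function, with s the sign of the real part. The real part is odd about
    the midpoint and integrates to 0; the imaginary part gives an arctangent. So every side
    contributes i pi/2 to the contour integral. *)
Definition inv_side (s e p x : R) : C :=
  (s * (x - p) / ((x - p) * (x - p) + e * e), e / ((x - p) * (x - p) + e * e)).

Lemma is_CRInt_inv_side (s e p : R) :
  0 < e -> is_CRInt (inv_side s e p) (p - e) (p + e) (0, PI / 2).
Proof.
  intros He. assert (N : forall x, 0 < (x - p) * (x - p) + e * e)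
    by (intros; generalize (Rle_0_sqr (x - p)) (Rmult_lt_0_compat e e He He); unfold Rsqr; lra).
  apply is_CRInt_pair; simpl.
  - evar_last.
    + apply (is_RInt_derive (fun x => s * ln ((x - p) * (x - p) + e * e) / 2)).
      * intros x _. specialize (N x). auto_derive; [easy|]. unfold Rminus in *. field. lra.
      * intros x _. specialize (N x). apply (ex_derive_continuous (fun x => _ / _)).
        auto_derive. unfold Rminus in *; lra.
    + simpl. unfold minus, plus, opp; simpl.
      replace ((p + e - p) * (p + e - p)) with ((p - e - p) * (p - e - p)) by ring. ring.
  - evar_last.
    + apply (is_RInt_derive (fun x => atan ((x - p) / e))).
      * intros x _. specialize (N x). auto_derive; [easy|]. unfold Rminus in *. field.
        unfold Rsqr. nra.
      * intros x _. specialize (N x). apply (ex_derive_continuous (fun x => _ / _)).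
        auto_derive. unfold Rminus in *; lra.
    + simpl. unfold minus, plus, opp; simpl.
      replace ((p + e - p) / e) with 1 by (field; lra).
      replace ((p - e - p) / e) with (Ropp 1) by (field; lra).
      rewrite (atan_opp 1), atan_1. field.
Qed.

Lemma rect_int_inv_square (p q e : R) :
  0 < e ->
  rect_int (fun z => / (z - (p, q)))%C (p - e) (p + e) (q - e) (q + e)
  = (2 * PI * Ci)%C.
Proof.
  intros He. assert (N : forall x, 0 < x * x + e * e)
    by (intros; generalize (Rle_0_sqr x) (Rmult_lt_0_compat e e He He); unfold Rsqr; lra).
  assert (X : forall r s g (k : C), (forall x, g x = (k * inv_side s e r x)%C) ->
      CRInt g (r - e) (r + e) = (k * ((0, PI / 2)%R : C))%C).
  { intros r s g k H.
    assert (W := is_CRInt_inv_side s e r He).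
    rewrite <- (@is_RInt_unique C_R_CompleteNormedModule _ _ _ _ W), <- CRInt_scal.
    - apply CRInt_ext; [lra|]. intros; apply H.
    - eexists. apply W. }
  unfold rect_int.
  rewrite (X p 1 (fun x => / ((x, q - e)%R - (p, q)))%C 1%C).
  2: { intros x. unfold inv_side. rewrite Cpair_minus, Cmult_1_l. unfold Cinv; simpl.
       specialize (N (x - p)). f_equal; field; nra. }
  rewrite (X p (-1) (fun x => / ((x, q + e)%R - (p, q)))%C (-(1))%C).
  2: { intros x. unfold inv_side. rewrite Cpair_minus. unfold Cinv, Copp, Cmult, RtoC; simpl.
       specialize (N (x - p)). f_equal; field; nra. }
  rewrite (X q 1 (fun y => / ((p + e, y)%R - (p, q)))%C (-Ci)%C).
  2: { intros x. unfold inv_side. rewrite Cpair_minus. unfold Cinv, Copp, Cmult, Ci, RtoC; simpl.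
       specialize (N (x - q)). f_equal; field; nra. }
  rewrite (X q (-1) (fun y => / ((p - e, y)%R - (p, q)))%C (Ci)%C).
  2: { intros x. unfold inv_side. rewrite Cpair_minus. unfold Cinv, Copp, Cmult, Ci, RtoC; simpl.
       specialize (N (x - q)). f_equal; field; nra. }
  unfold Cinv, Cminus, Cplus, Copp, Cmult, Ci, RtoC; simpl. f_equal; field.
Qed.

Lemma rect_int_inv (p q a b c d : R) :
  a < p < b -> c < q < d ->
  rect_int (fun z => / (z - (p, q)))%C a b c d = (2 * PI * Ci)%C.
Proof.
  intros Hp Hq.
  destruct (pos_lower_bound4 (p - a) (b - p) (q - c) (d - q)) as [e [He H]]; try lra.
  rewrite <- (rect_int_inv_square p q e He).
  apply rect_int_shrink with p q; try lra.
  intros z Hz. eexists. now apply has_cderiv_inv_minus.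
Qed.

Lemma cauchy_formula (f : C -> C) (p q a b c d : R) :
  a < p < b -> c < q < d -> (forall z, exists l, has_cderiv f z l) ->
  rect_int (fun z => f z * / (z - (p, q)))%C a b c d = (2 * PI * Ci * f (p, q))%C.
Proof.
  intros Hp Hq Hf.
  assert (B : forall x y, x = a \/ x = b \/ y = c \/ y = d -> ((x, y) : C) <> (p, q)).
  { intros x y Hb E. injection E. intros. lra. }
  assert (C1 : ccont_bdry (fun z => / (z - (p, q)))%C a b c d).
  { intros x y _ _ Hb. eapply has_cderiv_cont, has_cderiv_inv_minus. auto. }
  assert (C2 : ccont_bdry (fun z => (f z - f (p, q)) * / (z - (p, q)))%C a b c d).
  { intros x y _ _ Hb. destruct (Hf (x, y)) as [l Hl].
    eapply has_cderiv_cont, has_cderiv_mult.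
    - apply has_cderiv_minus_const, Hl.
    - apply has_cderiv_inv_minus. auto. }
  assert (C3 : ccont_bdry (fun z => f (p, q) * / (z - (p, q)))%C a b c d).
  { intros x y _ _ Hb. eapply has_cderiv_cont.
    apply (has_cderiv_mult (fun _ => f (p, q))).
    - apply has_cderiv_const.
    - apply has_cderiv_inv_minus. auto. }
  transitivity (rect_int (fun z => (f z - f (p, q)) * / (z - (p, q))
      + f (p, q) * / (z - (p, q)))%C a b c d).
  - apply rect_int_ext; try lra. intros x y _ _ Hb.
    assert (N := Cminus_neq_0 _ _ (B x y Hb)). field. exact N.
  - rewrite rect_int_plus, rect_int_removable, rect_int_scal, rect_int_inv; try lra; try easy.
    ring.
Qed.

(** * Divided differences *)

Fixpoint Csum (a : nat -> C) (n : nat) : C :=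
  match n with
  | O => 0%C
  | S m => (Csum a m + a m)%C
  end.

Lemma Csum_ext (a b : nat -> C) (n : nat) :
  (forall k, (k < n)%nat -> a k = b k) -> Csum a n = Csum b n.
Proof.
  induction n; intros H; [easy|]. simpl. rewrite IHn by auto. now rewrite H by lia.
Qed.

Lemma Csum_mult_r (a : nat -> C) (k : C) (n : nat) :
  (Csum a n * k)%C = Csum (fun j => a j * k)%C n.
Proof. induction n; simpl; [ring|]. rewrite <- IHn. ring. Qed.

Lemma Csum_plus (a b : nat -> C) (n : nat) :
  (Csum a n + Csum b n)%C = Csum (fun j => a j + b j)%C n.
Proof. induction n; simpl; [ring|]. rewrite <- IHn. ring. Qed.

Lemma Cmod_Csum_le (a : nat -> C) (M : R) (n : nat) :
  (forall k, (k < n)%nat -> Cmod (a k) <= M) -> Cmod (Csum a n) <= INR n * M.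
Proof.
  induction n; intros H; [simpl; rewrite Cmod_0; lra|].
  rewrite S_INR, Rmult_plus_distr_r, Rmult_1_l. simpl. apply Cmod_plus_le; auto.
Qed.

(* The coefficient of [f (x k)] in the divided difference of [f] at
   [x 0], ..., [x (n - 1)], built by adding the nodes one at a time. *)
Fixpoint dd_weight (x : nat -> C) (n k : nat) : C :=
  match n with
  | O => 0%C
  | S m => if Nat.eq_dec k m then (/ Cprod (fun j => x m - x j) m)%C
           else (dd_weight x m k * / (x k - x m))%C
  end.

Lemma Cprod_neq_0 (a : nat -> C) (n : nat) :
  (forall k, (k < n)%nat -> a k <> 0%C) -> Cprod a n <> 0%C.
Proof.
  induction n; intros H; simpl; [apply C1_nz|]. apply Cmult_neq_0; auto.
Qed.

(** The weights are the residues of 1/prod (z - x_j). This merges the Cauchy kernels of all nodes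
    into one kernel, whose denominator is large far from the nodes. *)
Lemma partial_fractions (x : nat -> C) (n : nat) (z : C) :
  (1 <= n)%nat ->
  (forall i j, (i < n)%nat -> (j < i)%nat -> x i <> x j) ->
  (forall k, (k < n)%nat -> z <> x k) ->
  Csum (fun k => dd_weight x n k * / (z - x k))%C n = (/ Cprod (fun j => z - x j) n)%C.
Proof.
  intros Hn. revert z. induction n; [lia|]. clear Hn. intros z Hx Hz.
  assert (Nz : forall k, (k < S n)%nat -> (z - x k)%C <> 0%C)
    by (intros; apply Cminus_neq_0; auto).
  destruct (Nat.eq_dec n 0) as [->|Hn].
  - simpl. specialize (Nz O ltac:(lia)). field. exact Nz.
  - cbn [Csum Cprod].
    assert (Nx : forall k, (k < n)%nat -> (x n - x k)%C <> 0%C)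
      by (intros; apply Cminus_neq_0; apply Hx; lia).
    (* The identity 1/((x_k - x_n)(z - x_k)) = 1/((z - x_k)(z - x_n)) - 1/((x_n - x_k)(z - x_n))
       splits the sum. The induction hypothesis is used at z and at x_n; the second use cancels the
       term of the new node. *)
    rewrite (Csum_ext _ (fun k => dd_weight x n k * / (z - x k) * / (z - x n)
      + dd_weight x n k * / (x n - x k) * (- / (z - x n)))%C).
    + rewrite <- Csum_plus, <- !Csum_mult_r.
      rewrite (IHn ltac:(lia) z), (IHn ltac:(lia) (x n)); auto.
      simpl. destruct (Nat.eq_dec n n) as [_|]; [|easy].
      assert (P1 : Cprod (fun j => z - x j)%C n <> 0%C) by (apply Cprod_neq_0; auto).
      assert (P2 : Cprod (fun j => x n - x j)%C n <> 0%C) by (apply Cprod_neq_0; auto).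
      specialize (Nz n ltac:(lia)). field. auto.
    + intros k Hk. simpl. destruct (Nat.eq_dec k n) as [->|_]; [lia|].
      assert (N1 := Nz k ltac:(lia)). assert (N2 := Nz n ltac:(lia)). assert (N3 := Nx k Hk).
      assert (N4 : (x k - x n)%C <> 0%C).
      { replace (x k - x n)%C with (- (1) * (x n - x k))%C by ring.
        apply Cmult_neq_0; [|easy]. intros E. apply C1_nz.
        replace (RtoC 1) with (- - (1))%C by ring. rewrite E. ring. }
      field. auto.
Qed.

(** Cauchy's formula at every node and [partial_fractions] turn the divided difference into 1/(2 pi
    i) times the contour integral of f(z)/prod (z - x_j), which is bounded by perimeter times
    maximum. *)
Lemma divided_difference_bound (f : C -> C) (x : nat -> C) (n : nat) (a b c d M : R) :
  (1 <= n)%nat -> (forall z, exists l, has_cderiv f z l) ->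
  (forall i j, (i < n)%nat -> (j < i)%nat -> x i <> x j) ->
  (forall k, (k < n)%nat -> a < Re (x k) < b /\ c < Im (x k) < d) ->
  (forall u v, a <= u <= b -> c <= v <= d -> u = a \/ u = b \/ v = c \/ v = d ->
     Cmod (f (u, v) * / Cprod (fun j => (u, v) - x j) n)%C <= M) ->
  2 * PI * Cmod (Csum (fun k => dd_weight x n k * f (x k)) n)%C
  <= 2 * ((b - a) + (d - c)) * M.
Proof.
  intros Hn Hf Hx Hin HM.
  assert (Hab : a <= b) by (destruct (Hin O ltac:(lia)); lra).
  assert (Hcd : c <= d) by (destruct (Hin O ltac:(lia)); lra).
  assert (B : forall k u v, (k < n)%nat -> u = a \/ u = b \/ v = c \/ v = d ->
    ((u, v) : C) <> x k).
  { intros k u v Hk Hb E. specialize (Hin k Hk). rewrite <- E in Hin. simpl in Hin. lra. }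
  assert (HM' : forall u v, a <= u <= b -> c <= v <= d -> u = a \/ u = b \/ v = c \/ v = d ->
     Cmod (Csum (fun k => dd_weight x n k * (f (u, v) * / ((u, v) - x k))) n)%C <= M).
  { intros u v Hu Hv Hb. eapply Rle_trans; [right|apply (HM u v Hu Hv Hb)]. f_equal.
    rewrite <- (partial_fractions x n (u, v)); auto.
    rewrite Cmult_comm, Csum_mult_r. apply Csum_ext. intros; ring. }
  assert (Q : forall (k : nat) u v, (k < n)%nat -> u = a \/ u = b \/ v = c \/ v = d ->
    exists l, has_cderiv (fun z => f z * / (z - x k))%C (u, v) l).
  { intros k u v Hk Hb. destruct (Hf (u, v)) as [l Hl]. eexists. apply has_cderiv_mult; [apply Hl|].
    apply has_cderiv_inv_minus. auto. }
  (* The sum is lengthened one node at a time with the weights of all [n] nodes kept fixed; the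
     empty sum counts as an affine function. *)
  assert (Hm : forall m, (m <= n)%nat ->
    ccont_bdry (fun z => Csum (fun k => dd_weight x n k * (f z * / (z - x k))) m)%C a b c d /\
    rect_int (fun z => Csum (fun k => dd_weight x n k * (f z * / (z - x k))) m)%C a b c d
    = (2 * PI * Ci * Csum (fun k => dd_weight x n k * f (x k)) m)%C).
  { induction m; intros Hmn.
    - simpl. split.
      + intros u v _ _ _. eapply has_cderiv_cont, has_cderiv_const.
      + transitivity (rect_int (fun u => 0 + 0 * (u - 0))%C a b c d).
        * apply rect_int_ext; try easy. intros; ring.
        * rewrite rect_int_affine. ring.
    - destruct (IHm ltac:(lia)) as [Hc Hi].
      assert (C1 : ccont_bdry (fun z => f z * / (z - x m))%C a b c d).
      { intros u v _ _ Hb. destruct (Q m u v ltac:(lia) Hb) as [l Hl].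
        eapply has_cderiv_cont, Hl. }
      assert (C2 : ccont_bdry (fun z => dd_weight x n m * (f z * / (z - x m)))%C a b c d).
      { intros u v _ _ Hb. destruct (Q m u v ltac:(lia) Hb) as [l Hl].
        eapply has_cderiv_cont, (has_cderiv_mult (fun _ => dd_weight x n m)); [apply has_cderiv_const|apply Hl]. }
      split.
      + intros u v H1 H2 Hb. simpl. apply ccont_plus; [now apply Hc|now apply C2].
      + simpl. rewrite rect_int_plus, Hi, rect_int_scal; try easy.
        destruct (Hin m ltac:(lia)) as [H1 H2].
        rewrite (surjective_pairing (x m)). rewrite cauchy_formula; try easy. ring. }
  destruct (Hm n (Nat.le_refl n)) as [Hc Hi].
  apply Rle_trans with (2 := rect_int_bound _ a b c d M Hab Hcd Hc HM').
  rewrite Hi, !Cmod_mult, Cmod_Ci, !Cmod_R.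
  generalize PI_RGT_0. intros HP. rewrite !Rabs_pos_eq by lra. lra.
Qed.


(** * Interpolation at equispaced points of a segment *)

(** Binomial coefficients are at most 2^n, in a form without division; the induction step is
    Pascal's rule. *)
Lemma fact_add_le (a b : nat) : (fact (a + b) <= 2 ^ (a + b) * (fact a * fact b))%nat.
Proof.
  assert (H : forall n a b, (a + b = n)%nat -> (fact n <= 2 ^ n * (fact a * fact b))%nat).
  { induction n; intros p q Hpq.
    - destruct p; destruct q; try lia. simpl. lia.
    - destruct p.
      + simpl in Hpq. subst q. change (fact 0) with 1%nat.
        assert (1 <= 2 ^ S n)%nat by (apply Nat.pow_le_mono_r with (a := 2%nat) (b := O); lia).
        nia.
      + destruct q.
        * rewrite Nat.add_0_r in Hpq. rewrite Hpq. change (fact 0) with 1%nat.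
          assert (1 <= 2 ^ S n)%nat by (apply Nat.pow_le_mono_r with (a := 2%nat) (b := O); lia).
          nia.
        * assert (H1 := IHn p (S q) ltac:(lia)). assert (H2 := IHn (S p) q ltac:(lia)).
          assert (E : fact (S n) = (S p * fact n + S q * fact n)%nat).
          { change (fact (S n)) with (S n * fact n)%nat. rewrite <- Hpq. lia. }
          rewrite E.
          change (2 ^ S n)%nat with (2 * 2 ^ n)%nat.
          assert (E1 : fact (S p) = (S p * fact p)%nat) by reflexivity.
          assert (E2 : fact (S q) = (S q * fact q)%nat) by reflexivity.
          apply (Nat.mul_le_mono_l _ _ (S p)) in H1.
          apply (Nat.mul_le_mono_l _ _ (S q)) in H2.
          rewrite E1 in *. rewrite E2 in *. nia. }
  now apply H.
Qed.

Lemma INR_fact_pos (n : nat) : 0 < INR (fact n).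
Proof. apply lt_0_INR, lt_O_fact. Qed.

(** A weak Stirling bound: m^m/m! is one term of the series of e^m, and e <= 3. *)
Lemma pow_le_pow3_fact (m : nat) : INR m ^ m <= 3 ^ m * INR (fact m).
Proof.
  assert (H := exp_ge_taylor (INR m) m (pos_INR m)).
  assert (H1 : INR m ^ m / INR (fact m) <= exp (INR m)).
  { eapply Rle_trans; [|apply H]. destruct m; [simpl; lra|].
    rewrite tech5. assert (0 <= sum_f_R0 (fun k => INR (S m) ^ k / INR (fact k)) m); [|lra].
    apply cond_pos_sum. intros k. apply Rmult_le_pos; [apply pow_le, pos_INR|].
    apply Rlt_le, Rinv_0_lt_compat, INR_fact_pos. }
  assert (H2 : exp (INR m) <= 3 ^ m).
  { clear. induction m; [simpl; rewrite exp_0; lra|].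
    rewrite S_INR, exp_plus, Rmult_comm. simpl.
    apply Rmult_le_compat; try (apply Rlt_le, exp_pos); [apply exp_le_3|easy]. }
  assert (P := INR_fact_pos m).
  apply Rmult_le_reg_r with (/ INR (fact m)); [now apply Rinv_0_lt_compat|].
  rewrite Rmult_assoc, Rinv_r by lra. unfold Rdiv in H1. lra.
Qed.

Lemma Cmod_Cprod_le (a : nat -> C) (M : R) (n : nat) :
  (forall k, (k < n)%nat -> Cmod (a k) <= M) -> Cmod (Cprod a n) <= M ^ n.
Proof.
  induction n; intros H; simpl; [rewrite Cmod_1; lra|].
  rewrite Cmod_mult, Rmult_comm. apply Rmult_le_compat; try apply Cmod_ge_0; auto.
Qed.

Lemma Cmod_Cprod_ge (a : nat -> C) (M : R) (n : nat) :
  0 <= M -> (forall k, (k < n)%nat -> M <= Cmod (a k)) -> M ^ n <= Cmod (Cprod a n).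
Proof.
  intros HM. induction n; intros H; simpl; [rewrite Cmod_1; lra|].
  rewrite Cmod_mult, Rmult_comm. apply Rmult_le_compat; auto. now apply pow_le.
Qed.

Section EquispacedWeights.

Variables (x : nat -> C) (m : nat) (t delta : R).
Hypothesis Hdelta : 0 < delta.
Hypothesis Hx : forall k, (k <= m)%nat -> x k = RtoC (t + INR k * delta).

Lemma equispaced_dist (j k : nat) :
  (j <= k)%nat -> (k <= m)%nat ->
  Cmod (x k - x j)%C = INR (k - j) * delta /\ Cmod (x j - x k)%C = INR (k - j) * delta.
Proof.
  intros Hjk Hk. rewrite (Cmod_minus_sym (x j)). rewrite !Hx by lia.
  rewrite <- RtoC_minus, Cmod_R.
  replace (t + INR k * delta - (t + INR j * delta)) with (INR (k - j) * delta)
    by (rewrite minus_INR by easy; ring).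
  rewrite Rabs_pos_eq; [easy|]. apply Rmult_le_pos; [apply pos_INR|lra].
Qed.

Lemma equispaced_Cprod (q p : nat) :
  (q <= m)%nat -> (p <= q)%nat ->
  Cmod (Cprod (fun j => x q - x j)%C p) * INR (fact (q - p)) = delta ^ p * INR (fact q).
Proof.
  intros Hq. induction p; intros Hp; cbn [Cprod pow].
  - rewrite Cmod_1, Nat.sub_0_r. ring.
  - rewrite Cmod_mult. destruct (equispaced_dist p q) as [E _]; [lia|lia|]. rewrite E.
    rewrite Rmult_assoc, (Rmult_assoc delta), <- IHp by lia. replace (q - p)%nat with (S (q - S p)) by lia.
    rewrite fact_simpl, mult_INR. ring.
Qed.

(** The classical weight 1/(delta^n k! (n - k)!), without division. Adding node n + 1 divides by the
    distance (n + 1 - k) delta, which turns (n - k)! into (n + 1 - k)!. *)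
Lemma equispaced_weight (n k : nat) :
  (n <= m)%nat -> (k <= n)%nat ->
  Cmod (dd_weight x (S n) k) * (delta ^ n * (INR (fact k) * INR (fact (n - k)))) = 1.
Proof.
  assert (E0 : forall n, Cprod (fun j => x n - x j)%C n <> 0%C \/ (m < n)%nat).
  { intros j. destruct (le_lt_dec j m) as [H|H]; [left|now right].
    apply Cprod_neq_0. intros i Hi. apply Cmod_gt_0.
    destruct (equispaced_dist i j) as [-> _]; [lia|lia|].
    apply Rmult_lt_0_compat; [apply lt_0_INR; lia|easy]. }
  assert (Etop : forall n, (n <= m)%nat ->
    Cmod (dd_weight x (S n) n) * (delta ^ n * (INR (fact n) * INR (fact (n - n)))) = 1).
  { clear n. intros n Hn. simpl. destruct (Nat.eq_dec n n) as [_|]; [|easy].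
    destruct (E0 n) as [H|H]; [|lia]. rewrite Cmod_inv by easy.
    rewrite <- Rmult_assoc with (r1 := delta ^ n), <- (equispaced_Cprod n n) by lia.
    rewrite Nat.sub_diag. simpl. apply Cmod_gt_0 in H. field. lra. }
  induction n; intros Hn Hk.
  - replace k with O by lia. now apply Etop.
  - destruct (Nat.eq_dec k (S n)) as [->|Hk']; [now apply Etop|].
    replace (dd_weight x (S (S n)) k) with (dd_weight x (S n) k * / (x k - x (S n)))%C.
    2: { simpl. destruct (Nat.eq_dec k (S n)); [lia|]. easy. }
    destruct (equispaced_dist k (S n)) as [_ E]; [lia|lia|].
    assert (P : 0 < INR (S n - k) * delta)
      by (apply Rmult_lt_0_compat; [apply lt_0_INR; lia|easy]).
    rewrite Cmod_mult, Cmod_inv, E by (apply Cmod_gt_0; lra).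
    rewrite <- (IHn ltac:(lia) ltac:(lia)).
    replace (S n - k)%nat with (S (n - k)) in * by lia.
    rewrite fact_simpl, mult_INR. simpl pow.
    assert (INR (S (n - k)) <> 0) by (apply not_0_INR; lia).
    field. lra.
Qed.

(** With l = m delta the weight is at most (6/l)^m: a factor 3^m from m^m <= 3^m m! and 2^m from the
    binomial coefficient. *)
Lemma equispaced_weight_le (k : nat) :
  (k <= m)%nat -> Cmod (dd_weight x (S m) k) * (delta ^ m * INR m ^ m) <= 6 ^ m.
Proof.
  intros Hk. assert (E := equispaced_weight m k (Nat.le_refl m) Hk).
  assert (F := fact_add_le k (m - k)). apply le_INR in F.
  replace (k + (m - k))%nat with m in F by lia.
  rewrite !mult_INR, pow_INR in F. change (INR 2) with 2 in F.
  set (c := Cmod (dd_weight x (S m) k)) in *. assert (Hc : 0 <= c) by apply Cmod_ge_0.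
  assert (Hd : 0 < delta ^ m) by now apply pow_lt.
  apply Rle_trans with (c * (delta ^ m * (3 ^ m * (2 ^ m * (INR (fact k) * INR (fact (m - k))))))).
  - repeat (apply Rmult_le_compat_l; [lra|]).
    eapply Rle_trans; [apply pow_le_pow3_fact|].
    apply Rmult_le_compat_l; [apply pow_le; lra|easy].
  - right. replace 6 with (3 * 2) by lra. rewrite Rpow_mult_distr.
    transitivity (c * (delta ^ m * (INR (fact k) * INR (fact (m - k)))) * (3 ^ m * 2 ^ m)); [ring|].
    rewrite E. ring.
Qed.

End EquispacedWeights.

Lemma INR_S_le_pow2 (m : nat) : INR (S m) <= 2 ^ m.
Proof.
  induction m; [simpl; lra|]. rewrite S_INR. simpl pow.
  assert (1 <= INR (S m)) by (rewrite S_INR; generalize (pos_INR m); lra). lra.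
Qed.

Lemma Im_le_Cmod (z : C) : Rabs (Im z) <= Cmod z.
Proof. eapply Rle_trans; [apply Rmax_r|apply Rmax_Cmod]. Qed.

(** Let P be the product of the differences z0 - x_j over the m + 1 points of the segment. The
    divided difference at these points and z0 is f(z0)/P plus terms controlled by [E], and it is
    small by the contour bound. Solving for f(z0) gives both summands. *)
Lemma entire_small_on_segment (f : C -> C) (z0 : C) (t l E M : R) (m : nat) :
  (forall z, exists d, has_cderiv f z d) ->
  Im z0 <> 0 -> 0 < l -> (1 <= m)%nat -> 0 <= E ->
  (forall s : R, t <= s <= t + l -> Cmod (f (RtoC s)) <= E) ->
  (forall z : C, Cmod z <= 6 * (Rabs t + l + Cmod z0) -> Cmod (f z) <= M) ->
  let B := Rabs t + l + Cmod z0 in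
  Cmod (f z0) <= B / Rabs (Im z0) * (12 * B / l) ^ m * E + M / 2 ^ m.
Proof.
  intros Hf Hz0 Hl Hm HE Hseg HM B.
  set (eta := Rabs (Im z0)). assert (Heta : 0 < eta) by now apply Rabs_pos_lt.
  assert (HetaB : eta <= Cmod z0) by apply Im_le_Cmod.
  assert (Ht := Rabs_pos t).
  assert (HB : 0 < B) by (unfold B; lra).
  assert (Hm0 : 0 < INR m) by (apply lt_0_INR; lia).
  set (delta := l / INR m). assert (Hdelta : 0 < delta) by now apply Rdiv_lt_0_compat.
  (* Indices 0 to m are the points of the segment; index m + 1 is [z0]. *)
  set (x := fun k => if le_lt_dec k m then RtoC (t + INR k * delta) else z0).
  assert (Hx : forall k, (k <= m)%nat -> x k = RtoC (t + INR k * delta)).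
  { intros k Hk. unfold x. destruct (le_lt_dec k m); [easy|lia]. }
  assert (Hxl : x (S m) = z0).
  { unfold x. destruct (le_lt_dec (S m) m); [lia|easy]. }
  assert (Hseg' : forall k, (k <= m)%nat -> t <= t + INR k * delta <= t + l).
  { intros k Hk. apply le_INR in Hk. assert (Hk0 := pos_INR k).
    replace l with (INR m * delta) by (unfold delta; field; lra). nra. }
  assert (Hmod : forall k, (k < S (S m))%nat -> Cmod (x k) <= B).
  { intros k Hk. destruct (Nat.eq_dec k (S m)) as [->|N].
    - rewrite Hxl. unfold B. lra.
    - rewrite Hx by lia. rewrite Cmod_R. generalize (Hseg' k ltac:(lia)). intros H.
      apply Rabs_le. generalize (Rle_abs t) (Rle_abs (- t)). rewrite Rabs_Ropp.
      generalize (Cmod_ge_0 z0). unfold B. lra. }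
  (* The points of the segment are real, so the imaginary part of z0 alone separates z0 from
     them. *)
  assert (Hsep : forall k, (k <= m)%nat -> eta <= Cmod (x k - z0)%C).
  { intros k Hk. rewrite Hx by easy. rewrite Cmod_minus_sym.
    replace eta with (Rabs (Im (z0 - RtoC (t + INR k * delta))%C)); [apply Im_le_Cmod|].
    unfold eta. f_equal. unfold Cminus, Im, Copp, Cplus; simpl. ring. }
  assert (Hdist : forall i j, (i < S (S m))%nat -> (j < i)%nat -> x i <> x j).
  { intros i j Hi Hj Eq. destruct (Nat.eq_dec i (S m)) as [->|N].
    - assert (K := Hsep j ltac:(lia)). rewrite <- Eq, Hxl in K.
      replace (z0 - z0)%C with (RtoC 0) in K by ring. rewrite Cmod_0 in K. lra.
    - destruct (equispaced_dist x m t delta Hdelta Hx j i) as [K _]; [lia|lia|].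
      rewrite Eq in K. replace (x j - x j)%C with (RtoC 0) in K by ring. rewrite Cmod_0 in K.
      assert (0 < INR (i - j) * delta); [|lra].
      apply Rmult_lt_0_compat; [apply lt_0_INR; lia|easy]. }
  assert (Hp2 : 0 < (2 * B) ^ S (S m)) by (apply pow_lt; lra).
  assert (HM0 : 0 <= M).
  { eapply Rle_trans; [apply Cmod_ge_0|apply (HM z0)]. unfold B in HB. lra. }
  (* All nodes have modulus at most B. On the boundary of the square of half-side 3B every factor z
     - x_j is therefore at least 2B, the perimeter is 24 B, and the corners stay in the disc of
     radius 6B. *)
  assert (D := divided_difference_bound f x (S (S m)) (- (3 * B)) (3 * B) (- (3 * B)) (3 * B)
    (M / (2 * B) ^ S (S m))).
  specialize (D ltac:(lia) Hf Hdist).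
  assert (D' : 2 * PI * Cmod (Csum (fun k => dd_weight x (S (S m)) k * f (x k))%C (S (S m)))
    <= 24 * B * (M / (2 * B) ^ S (S m))).
  { eapply Rle_trans; [apply D|right; ring].
    - intros k Hk. specialize (Hmod k Hk).
      assert (K1 := re_le_Cmod (x k)). assert (K2 := Im_le_Cmod (x k)).
      assert (K3 : Rabs (Re (x k)) <= B) by lra. assert (K4 : Rabs (Im (x k)) <= B) by lra.
      apply Rabs_le_between in K3. apply Rabs_le_between in K4. lra.
    - intros u v Hu Hv Hb.
      assert (Q : (2 * B) ^ S (S m) <= Cmod (Cprod (fun j => (u, v) - x j)%C (S (S m)))).
      { apply Cmod_Cprod_ge; [lra|]. intros k Hk.
        assert (K := Cmod_rev_triangle (u, v) (x k)). specialize (Hmod k Hk).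
        assert (3 * B <= Cmod (u, v)); [|lra].
        assert (K1 := re_le_Cmod (u, v)). assert (K2 := Im_le_Cmod (u, v)). simpl in K1, K2.
        destruct Hb as [->|[->|[->| ->]]]; rewrite ?Rabs_Ropp, ?(Rabs_pos_eq (3 * B)) in * by lra; lra. }
      rewrite Cmod_mult, Cmod_inv by (apply Cmod_gt_0; lra).
      apply Rmult_le_compat; try apply Cmod_ge_0.
      + apply Rlt_le, Rinv_0_lt_compat; lra.
      + apply HM. eapply Rle_trans; [apply Cmod_le_abs_sum|].
        apply Rabs_le in Hu. apply Rabs_le in Hv. fold B. lra.
      + apply Rinv_le_contravar; lra. }
  clear D.
  set (P := Cprod (fun j => z0 - x j)%C (S m)).
  assert (HP : Cmod P <= B ^ S m).
  { unfold P. apply Cmod_Cprod_le. intros k Hk.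
    rewrite (Hx k) by lia. specialize (Hseg' k ltac:(lia)).
    eapply Rle_trans; [apply Cmod_triangle|]. rewrite Cmod_opp, Cmod_R.
    assert (Rabs (t + INR k * delta) <= Rabs t + l); [|unfold B; lra].
    apply Rabs_le. generalize (Rle_abs t) (Rle_abs (- t)). rewrite Rabs_Ropp. lra. }
  assert (HP0 : P <> 0%C).
  { apply Cprod_neq_0. intros k Hk. apply Cmod_gt_0. rewrite Cmod_minus_sym.
    specialize (Hsep k ltac:(lia)). lra. }
  set (S1 := Csum (fun k => dd_weight x (S m) k * / (x k - z0) * f (x k))%C (S m)).
  assert (Esum : Csum (fun k => dd_weight x (S (S m)) k * f (x k))%C (S (S m))
    = (S1 + / P * f z0)%C).
  { change (Csum (fun k => dd_weight x (S (S m)) k * f (x k))%C (S (S m))) with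
      (Csum (fun k => dd_weight x (S (S m)) k * f (x k))%C (S m)
        + dd_weight x (S (S m)) (S m) * f (x (S m)))%C.
    f_equal.
    - unfold S1. apply Csum_ext. intros k Hk. rewrite <- Hxl. 
      cbn [dd_weight]. destruct (Nat.eq_dec k (S m)); [lia|]. easy.
    - unfold P. rewrite <- Hxl. f_equal.
      cbn [dd_weight]. destruct (Nat.eq_dec (S m) (S m)); [|lia]. easy. }
  rewrite Esum in D'. clear Esum.
  (* 12 = 6 * 2: the weights cost 6^m and the number m + 1 of terms at most 2^m. *)
  assert (HS1 : Cmod S1 <= (12 / l) ^ m * (E / eta)).
  { set (w := 6 ^ m / (delta ^ m * INR m ^ m) * (E / eta)).
    assert (Hden : 0 < delta ^ m * INR m ^ m).
    { apply Rmult_lt_0_compat; now apply pow_lt. }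
    assert (K : Cmod S1 <= INR (S m) * w).
    { apply Cmod_Csum_le. intros k Hk. rewrite !Cmod_mult.
      assert (K1 := equispaced_weight_le x m t delta Hdelta Hx k ltac:(lia)).
      specialize (Hsep k ltac:(lia)).
      rewrite Cmod_inv by (apply Cmod_gt_0; lra).
      unfold w, Rdiv. rewrite (Rmult_comm E), <- Rmult_assoc.
      apply Rmult_le_compat; try apply Cmod_ge_0.
      - apply Rmult_le_pos; [apply Cmod_ge_0|apply Rlt_le, Rinv_0_lt_compat; lra].
      - apply Rmult_le_compat; try apply Cmod_ge_0.
        + apply Rlt_le, Rinv_0_lt_compat; lra.
        + apply Rmult_le_reg_r with (delta ^ m * INR m ^ m); [easy|].
          rewrite (Rmult_assoc (6 ^ m)), Rinv_l by lra. lra.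
        + apply Rinv_le_contravar; lra.
      - rewrite Hx by lia. apply Hseg, Hseg'. lia. }
    eapply Rle_trans; [apply K|].
    assert (Hw : 0 <= w).
    { unfold w. repeat apply Rmult_le_pos; try lra.
      - apply pow_le; lra.
      - apply Rlt_le, Rinv_0_lt_compat; lra.
      - apply Rlt_le, Rinv_0_lt_compat; lra. }
    eapply Rle_trans; [apply Rmult_le_compat_r; [apply Hw|apply INR_S_le_pow2]|].
    right. unfold w. rewrite <- Rpow_mult_distr.
    replace (delta * INR m) with l by (unfold delta; field; lra).
    unfold Rdiv. rewrite <- !Rmult_assoc, <- Rpow_mult_distr.
    replace (2 * 6) with 12 by lra. now rewrite <- pow_inv, <- Rpow_mult_distr. }
  (* Using 6 in place of 2 pi makes the constant of M/2^m exactly 24/(6 * 2 * 2) = 1. *)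
  assert (HPI : 6 < 2 * PI) by (generalize PI2_3_2; lra).
  set (r := 24 * B * (M / (2 * B) ^ S (S m))) in *.
  assert (Hr : 0 <= r).
  { unfold r. repeat apply Rmult_le_pos; try lra. apply Rlt_le, Rinv_0_lt_compat; lra. }
  assert (D2 : Cmod (S1 + / P * f z0)%C <= r / 6).
  { assert (Hc := Cmod_ge_0 (S1 + / P * f z0)%C). nra. }
  assert (D3 : Cmod (/ P * f z0)%C <= r / 6 + (12 / l) ^ m * (E / eta)).
  { replace (/ P * f z0)%C with ((S1 + / P * f z0) + - S1)%C by ring.
    apply Cmod_plus_le; [easy|]. now rewrite Cmod_opp. }
  rewrite Cmod_mult, Cmod_inv in D3 by easy.
  assert (HP1 : 0 < Cmod P) by now apply Cmod_gt_0.
  assert (D4 : Cmod (f z0) <= Cmod P * (r / 6 + (12 / l) ^ m * (E / eta))).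
  { apply Rmult_le_compat_l with (r := Cmod P) in D3; [|lra].
    rewrite <- Rmult_assoc, Rinv_r, Rmult_1_l in D3 by lra. easy. }
  eapply Rle_trans; [apply D4|].
  assert (HA : 0 <= (12 / l) ^ m * (E / eta)).
  { apply Rmult_le_pos; [apply pow_le|].
    - apply Rlt_le, Rdiv_lt_0_compat; lra.
    - apply Rmult_le_pos; [easy|apply Rlt_le, Rinv_0_lt_compat; lra]. }
  eapply Rle_trans; [apply Rmult_le_compat_r; [lra|apply HP]|].
  right. unfold r. change ((2 * B) ^ S (S m)) with (2 * B * (2 * B * (2 * B) ^ m)).
  change (B ^ S m) with (B * B ^ m).
  assert (B ^ m <> 0) by (apply pow_nonzero; lra).
  assert (2 ^ m <> 0) by (apply pow_nonzero; lra).
  replace ((12 * B / l) ^ m) with (B ^ m * (12 / l) ^ m)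
    by (rewrite <- Rpow_mult_distr; f_equal; field; lra).
  rewrite (Rpow_mult_distr 2 B). generalize ((12 / l) ^ m). intros Y. field. lra.
Qed.


(** * Logarithmic inequalities and finite sums *)

Lemma ln_le_tangent (a p : R) : 0 < a -> 0 < p -> ln a <= ln p + (a - p) / p.
Proof.
  intros Ha Hp.
  assert (H := exp_ineq1_le (ln a - ln p)).
  unfold Rminus in H. rewrite exp_plus, exp_Ropp, !exp_ln in H by easy.
  replace ((a - p) / p) with (a * / p - 1) by (field; lra). lra.
Qed.

Lemma ln_1p_le (x : R) : 0 <= x -> ln (1 + x) <= x.
Proof.
  intros H. generalize (ln_le_tangent (1 + x) 1). rewrite ln_1. lra.
Qed.

Lemma ln_nonneg (x : R) : 1 <= x -> 0 <= ln x.
Proof. intros H. rewrite <- ln_1. apply ln_le; lra. Qed.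

(** Bernoulli's inequality 1 + k u <= (1 + u)^k in logarithms, valid for real k. The tangent of ln
    at 1 + u is evaluated at 1 + k u and at 1; k - 1 times the second estimate is added to the
    first. *)
Lemma ln_bernoulli (k u : R) : 1 <= k -> 0 <= u -> ln (1 + k * u) <= k * ln (1 + u).
Proof.
  intros Hk Hu. assert (0 <= k * u) by nra.
  assert (H1 := ln_le_tangent (1 + k * u) (1 + u)).
  assert (H2 := ln_le_tangent 1 (1 + u)). rewrite ln_1 in H2.
  assert (H3 : 0 <= (k - 1) * (ln (1 + u) + (1 - (1 + u)) / (1 + u))).
  { apply Rmult_le_pos; [lra|]. apply H2; lra. }
  assert (E : (1 + k * u - (1 + u)) / (1 + u) = - ((k - 1) * ((1 - (1 + u)) / (1 + u))))
    by (field; lra).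
  rewrite E in H1. rewrite Rmult_plus_distr_l in H3.
  specialize (H1 ltac:(lra) ltac:(lra)). lra.
Qed.

(* [x -> x ln(1 + t/x)] is nondecreasing, so no condition [x <= t/e] is
   needed, in contrast with [x ln(t/x)]. *)
Lemma x_ln_1p_inv_mono (t x y : R) :
  0 <= t -> 0 < x -> x <= y -> x * ln (1 + t / x) <= y * ln (1 + t / y).
Proof.
  intros Ht Hx Hxy.
  assert (0 <= t / y) by (apply Rmult_le_pos; [lra|apply Rlt_le, Rinv_0_lt_compat; lra]).
  assert (Hk : 1 <= y / x).
  { apply Rmult_le_reg_r with x; [easy|]. unfold Rdiv. rewrite Rmult_assoc, Rinv_l; lra. }
  assert (B := ln_bernoulli (y / x) (t / y) Hk H).
  replace (y / x * (t / y)) with (t / x) in B by (field; lra).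
  apply Rmult_le_compat_l with (r := x) in B; [|lra].
  replace (x * (y / x * ln (1 + t / y))) with (y * ln (1 + t / y)) in B by (field; lra). lra.
Qed.

(** ln |1 + i x|, the contribution of one factor of the product on the real line. *)
Definition phi (x : R) : R := ln (1 + x * x) / 2.

Lemma phi_nonneg (x : R) : 0 <= phi x.
Proof. unfold phi. assert (0 <= ln (1 + x * x)); [apply ln_nonneg; nra|lra]. Qed.

Lemma phi_mono (x y : R) : 0 <= x -> x <= y -> phi x <= phi y.
Proof.
  intros Hx Hy. unfold phi. assert (ln (1 + x * x) <= ln (1 + y * y)); [|lra].
  apply ln_le; nra.
Qed.

Lemma phi_pos (x : R) : 0 < x -> 0 < phi x.
Proof.
  intros Hx. unfold phi. assert (ln 1 < ln (1 + x * x)); [|rewrite ln_1 in *; lra].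
  apply ln_increasing; nra.
Qed.

Lemma phi_scale (k x : R) : 1 <= k -> phi (k * x) <= k * k * phi x.
Proof.
  intros Hk. unfold phi. assert (B := ln_bernoulli (k * k) (x * x)).
  specialize (B ltac:(nra) ltac:(nra)).
  replace (k * x * (k * x)) with (k * k * (x * x)) by ring. lra.
Qed.

Lemma phi_le_id (x : R) : 0 <= x -> phi x <= x.
Proof.
  intros Hx. apply Rle_trans with (ln (1 + x)); [|now apply ln_1p_le].
  unfold phi. assert (H : ln (1 + x * x) <= ln ((1 + x) * (1 + x))) by (apply ln_le; nra).
  rewrite ln_mult in H by lra. lra.
Qed.

Lemma phi_ge_1 (x : R) : 1 <= x -> / 4 <= phi x.
Proof.
  intros Hx. apply Rle_trans with (2 := phi_mono 1 x ltac:(lra) Hx).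
  unfold phi. replace (1 + 1 * 1) with 2 by ring. generalize ln_lt_2. lra.
Qed.

Lemma phi_opp (x : R) : phi (- x) = phi x.
Proof. unfold phi. now rewrite Rmult_opp_opp. Qed.

Fixpoint rsum (a : nat -> R) (n : nat) : R :=
  match n with
  | O => 0
  | S m => rsum a m + a m
  end.

Lemma rsum_le (a b : nat -> R) (n : nat) :
  (forall j, (j < n)%nat -> a j <= b j) -> rsum a n <= rsum b n.
Proof.
  induction n; intros H; simpl; [lra|]. apply Rplus_le_compat; auto.
Qed.

Lemma rsum_ext (a b : nat -> R) (n : nat) :
  (forall j, (j < n)%nat -> a j = b j) -> rsum a n = rsum b n.
Proof.
  induction n; intros H; simpl; [lra|]. rewrite IHn, H by auto. easy.
Qed.

Lemma rsum_scal (k : R) (a : nat -> R) (n : nat) :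
  rsum (fun j => k * a j) n = k * rsum a n.
Proof. induction n; simpl; [ring|]. rewrite IHn. ring. Qed.

Lemma rsum_plus (a b : nat -> R) (n : nat) :
  rsum (fun j => a j + b j) n = rsum a n + rsum b n.
Proof. induction n; simpl; [ring|]. rewrite IHn. ring. Qed.

Lemma rsum_const (k : R) (n : nat) : rsum (fun _ => k) n = INR n * k.
Proof. induction n; [simpl; ring|]. simpl rsum. rewrite IHn, S_INR. ring. Qed.

Lemma rsum_add (a : nat -> R) (n m : nat) :
  rsum a (n + m) = rsum a n + rsum (fun j => a (n + j)%nat) m.
Proof.
  induction m; simpl; [rewrite Nat.add_0_r; ring|].
  rewrite Nat.add_succ_r. simpl. rewrite IHm. ring.
Qed.

Lemma rsum_nonneg (a : nat -> R) (n : nat) : (forall j, 0 <= a j) -> 0 <= rsum a n.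
Proof. intros H. induction n; simpl; [lra|]. specialize (H n). lra. Qed.

Lemma rsum_mono (a : nat -> R) (n m : nat) :
  (forall j, 0 <= a j) -> (n <= m)%nat -> rsum a n <= rsum a m.
Proof.
  intros H Hnm. replace m with (n + (m - n))%nat by lia. rewrite rsum_add.
  generalize (rsum_nonneg (fun j => a (n + j)%nat) (m - n) (fun j => H _)). lra.
Qed.

Lemma rsum_sum_n (a : nat -> R) (n : nat) : sum_n a n = rsum a (S n).
Proof.
  induction n; [rewrite sum_O; simpl; ring|]. rewrite sum_Sn, IHn. reflexivity.
Qed.

Lemma ex_series_rsum_bounded (a : nat -> R) :
  (forall j, 0 <= a j) -> ex_series a -> exists M, forall n, rsum a n <= M.
Proof.
  intros Ha [l Hl]. exists l. intros n.
  apply Rle_trans with (rsum a (S n)); [apply rsum_mono; auto|].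
  rewrite <- rsum_sum_n.
  apply (is_lim_seq_incr_compare (sum_n a) l); [apply Hl|].
  intros k. rewrite !rsum_sum_n. apply rsum_mono; auto.
Qed.

Lemma rsum_bounded_ex_series (a : nat -> R) (M : R) :
  (forall j, 0 <= a j) -> (forall n, rsum a n <= M) -> ex_series a.
Proof.
  intros Ha HM. destruct (ex_finite_lim_seq_incr (sum_n a) M) as [l Hl].
  - intros k. rewrite !rsum_sum_n. apply rsum_mono; auto.
  - intros k. rewrite rsum_sum_n. auto.
  - exists l. exact Hl.
Qed.

(** * Logarithms of products *)

(* [W] is [ln |omega|] on the real line for [omega] with reciprocal zeros [r]. *)
Definition log_growth (r : nat -> R) (W : R -> R) : Prop :=
  forall x, (forall n, rsum (fun j => phi (x * r j)) n <= W x) /\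
    (forall K, (forall n, rsum (fun j => phi (x * r j)) n <= K) -> W x <= K).

Section Growth.

Variables (r : nat -> R) (W : R -> R).
Hypothesis Hr : forall j, 0 <= r j.
Hypothesis Hr0 : 0 < r O.
Hypothesis HW : log_growth r W.

Lemma growth_nonneg (x : R) : 0 <= W x.
Proof. apply (proj1 (HW x) O). Qed.

Lemma growth_even (x : R) : W (- x) = W x.
Proof.
  assert (H : forall y, W (- y) <= W y).
  { intros y. apply (proj2 (HW (- y))). intros n.
    eapply Rle_trans; [|apply (proj1 (HW y) n)]. apply rsum_le. intros j _.
    rewrite <- phi_opp. right. f_equal. ring. }
  apply Rle_antisym; [apply H|]. rewrite <- (Ropp_involutive x) at 1. apply H.
Qed.

Lemma growth_abs (x : R) : W (Rabs x) = W x.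
Proof. unfold Rabs. destruct (Rcase_abs x); [apply growth_even|easy]. Qed.

Lemma growth_mono (x y : R) : 0 <= x -> x <= y -> W x <= W y.
Proof.
  intros Hx Hy. apply (proj2 (HW x)). intros n.
  eapply Rle_trans; [|apply (proj1 (HW y) n)]. apply rsum_le. intros j _.
  apply phi_mono; [apply Rmult_le_pos; auto|]. apply Rmult_le_compat_r; auto.
Qed.

Lemma growth_pos (x : R) : 0 < x -> 0 < W x.
Proof.
  intros Hx. eapply Rlt_le_trans; [|apply (proj1 (HW x) 1%nat)]. simpl.
  rewrite Rplus_0_l. apply phi_pos. now apply Rmult_lt_0_compat.
Qed.

Lemma growth_scale (k x : R) : 1 <= k -> W (k * x) <= k * k * W x.
Proof.
  intros Hk. apply (proj2 (HW (k * x))). intros n.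
  apply Rle_trans with (k * k * rsum (fun j => phi (x * r j)) n).
  - rewrite <- rsum_scal. apply rsum_le. intros j _. rewrite Rmult_assoc. now apply phi_scale.
  - apply Rmult_le_compat_l; [nra|]. apply HW.
Qed.

Lemma growth_linear (M x : R) : (forall n, rsum r n <= M) -> 0 <= x -> W x <= M * x.
Proof.
  intros HM Hx. apply (proj2 (HW x)). intros n.
  apply Rle_trans with (x * rsum r n).
  - rewrite <- rsum_scal. apply rsum_le. intros j _. apply phi_le_id.
    apply Rmult_le_pos; auto.
  - rewrite Rmult_comm. apply Rmult_le_compat_r; auto.
Qed.

(** The tail of the series beyond some N contributes at most eps x / 3 by phi(y) <= y; the first N
    factors grow only logarithmically. *)
Lemma growth_little_o (eps : R) :
  (forall j, r (S j) <= r j) ->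
  ex_series r -> 0 < eps -> exists T, 1 <= T /\ forall x, T <= x -> W x <= eps * x.
Proof.
  intros Hdec Hs He.
  assert (HN : exists N, forall m, rsum (fun j => r (N + j)%nat) m <= eps / 3).
  { destruct (Cauchy_ex_series r Hs (mkposreal (eps / 3) ltac:(lra))) as [N HN].
    exists (S N). intros m. destruct m; [simpl; lra|].
    specialize (HN (S N) (S N + m)%nat ltac:(lia) ltac:(lia)).
    unfold norm in HN; simpl in HN. unfold abs in HN; simpl in HN.
    apply Rabs_lt_between in HN.
    replace (rsum (fun j => r (S N + j)%nat) (S m)) with (sum_n_m r (S N) (S (N + m))); [apply Rlt_le, HN|].
    clear HN. induction m.
    - rewrite Nat.add_0_r, sum_n_n. simpl. rewrite Nat.add_0_r. ring.
    - rewrite Nat.add_succ_r, sum_n_Sm by lia. rewrite IHm. simpl.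
      rewrite (Nat.add_succ_r N m). reflexivity. }
  destruct HN as [N HN].
  assert (Hle : forall j, r j <= r O).
  { induction j; [lra|]. eapply Rle_trans; [apply Hdec|easy]. }
  (* Bounding ln by its tangent at [A] replaces the logarithm by a slope 1/A and a constant. This
     [A] makes N + 1 such slopes cost at most eps x / 3 when x >= 1, and [B] collects the
     constants. *)
  set (A := 3 * (INR N + 1) * (r O + 1) / eps).
  assert (HA : 0 < A).
  { unfold A. generalize (pos_INR N). intros. apply Rdiv_lt_0_compat; [|easy].
    repeat apply Rmult_lt_0_compat; lra. }
  set (B := (INR N + 1) * Rmax 0 (ln A)).
  assert (HB : 0 <= B) by (unfold B; generalize (pos_INR N) (Rmax_l 0 (ln A)); intros; apply Rmult_le_pos; lra).
  exists (Rmax 1 (3 * B / eps)). split; [apply Rmax_l|]. intros x Hx.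
  assert (Hx1 := Rle_trans _ _ _ (Rmax_l _ _) Hx).
  assert (Hx2 := Rle_trans _ _ _ (Rmax_r _ _) Hx).
  apply (proj2 (HW x)). intros n.
  apply Rle_trans with (rsum (fun j => phi (x * r j)) (N + n)).
  { apply rsum_mono; [intros; apply phi_nonneg|lia]. }
  rewrite rsum_add.
  assert (H1 : rsum (fun j => phi (x * r (N + j)%nat)) n <= eps / 3 * x).
  { apply Rle_trans with (x * rsum (fun j => r (N + j)%nat) n).
    - rewrite <- rsum_scal. apply rsum_le. intros j _. apply phi_le_id.
      apply Rmult_le_pos; [lra|auto].
    - specialize (HN n). nra. }
  assert (H2 : forall j, phi (x * r j) <= ln (1 + x * r O)).
  { intros j. apply Rle_trans with (phi (x * r O)).
    - apply phi_mono; [apply Rmult_le_pos; [lra|auto]|]. apply Rmult_le_compat_l; [lra|auto].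
    - unfold phi. assert (0 <= x * r O) by (apply Rmult_le_pos; [lra|auto]).
      assert (K : ln (1 + x * r O * (x * r O)) <= ln ((1 + x * r O) * (1 + x * r O)))
        by (apply ln_le; nra).
      rewrite ln_mult in K by lra. lra. }
  assert (H3 : ln (1 + x * r O) <= (1 + x * r O) / A + Rmax 0 (ln A)).
  { assert (0 <= x * r O) by (apply Rmult_le_pos; [lra|auto]).
    assert (K := ln_le_tangent (1 + x * r O) A ltac:(lra) HA).
    replace ((1 + x * r O - A) / A) with ((1 + x * r O) / A - 1) in K by (field; lra).
    generalize (Rmax_r 0 (ln A)). lra. }
  assert (H4 : rsum (fun j => phi (x * r j)) N <= INR N * ((1 + x * r O) / A + Rmax 0 (ln A))).
  { rewrite <- rsum_const. apply rsum_le. intros j _. eapply Rle_trans; [apply H2|easy]. }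
  assert (H5 : (INR N + 1) * ((1 + x * r O) / A) <= eps / 3 * x).
  { unfold A. replace ((INR N + 1) * ((1 + x * r O) / (3 * (INR N + 1) * (r O + 1) / eps)))
      with (eps / 3 * ((1 + x * r O) / (r O + 1))).
    2: { generalize (pos_INR N). intros. field. lra. }
    apply Rmult_le_compat_l; [lra|]. apply Rmult_le_reg_r with (r O + 1); [lra|].
    unfold Rdiv. rewrite Rmult_assoc, Rinv_l by lra. nra. }
  assert (H6 : B <= eps / 3 * x).
  { apply Rmult_le_compat_r with (r := eps / 3) in Hx2; [|lra].
    replace (3 * B / eps * (eps / 3)) with B in Hx2 by (field; lra). lra. }
  unfold B in H6.
  assert (0 <= (1 + x * r O) / A + Rmax 0 (ln A)).
  { eapply Rle_trans; [|apply H3]. apply ln_nonneg. nra. }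
  assert (INR N * ((1 + x * r O) / A + Rmax 0 (ln A))
    <= (INR N + 1) * ((1 + x * r O) / A + Rmax 0 (ln A))) by nra.
  lra.
Qed.

(* A monotone substitute for [W ln(x / W)], the numerator of the integrand. *)
Definition Pt (x : R) : R := W x * ln (1 + x / W x).

Lemma Pt_mono (x y : R) : 0 < x -> x <= y -> Pt x <= Pt y.
Proof.
  intros Hx Hy. unfold Pt. assert (P1 := growth_pos x Hx). assert (P2 := growth_pos y ltac:(lra)).
  apply Rle_trans with (W y * ln (1 + x / W y)).
  - apply x_ln_1p_inv_mono; try lra. apply growth_mono; lra.
  - apply Rmult_le_compat_l; [lra|]. apply ln_le.
    + assert (0 < x / W y) by now apply Rdiv_lt_0_compat. lra.
    + apply Rplus_le_compat_l. apply Rmult_le_compat_r; [|easy].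
      apply Rlt_le, Rinv_0_lt_compat; lra.
Qed.

Lemma Pt_nonneg (x : R) : 0 < x -> 0 <= Pt x.
Proof.
  intros Hx. assert (P1 := growth_pos x Hx). apply Rmult_le_pos; [lra|]. apply ln_nonneg.
  assert (0 < x / W x) by now apply Rdiv_lt_0_compat. lra.
Qed.

(** Allows |t| + 1 to be replaced by |t| when |t| >= 1. The factor 4 is that of W(2x) <= 4 W(x). *)
Lemma Pt_double (x : R) : 0 < x -> Pt (2 * x) <= 4 * Pt x.
Proof.
  intros Hx. unfold Pt.
  assert (P1 := growth_pos x Hx). assert (P2 := growth_pos (2 * x) ltac:(lra)).
  apply Rle_trans with (4 * W x * ln (1 + 2 * x / (4 * W x))).
  - apply x_ln_1p_inv_mono; try lra. generalize (growth_scale 2 x). lra.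
  - rewrite Rmult_assoc. apply Rmult_le_compat_l; [lra|]. apply Rmult_le_compat_l; [lra|].
    assert (0 < x / W x) by now apply Rdiv_lt_0_compat.
    replace (2 * x / (4 * W x)) with (x / W x / 2) by (field; lra).
    apply ln_le; lra.
Qed.

(** Used in two ranges: a fixed k gives W = O([Pt]), and a tiny k, available far out since W = o(x),
    makes the factor ln(1 + 1/k) as large as desired. *)
Lemma Pt_ge_growth (x k : R) : 0 < x -> 0 < k -> W x <= k * x -> ln (1 + / k) * W x <= Pt x.
Proof.
  intros Hx Hk H. unfold Pt. assert (P1 := growth_pos x Hx).
  rewrite Rmult_comm. apply Rmult_le_compat_l; [lra|].
  assert (0 < / k) by now apply Rinv_0_lt_compat.
  apply ln_le; [lra|]. apply Rplus_le_compat_l.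
  apply Rmult_le_reg_r with (k * W x); [nra|].
  replace (/ k * (k * W x)) with (W x) by (field; lra).
  replace (x / W x * (k * W x)) with (k * x) by (field; lra). easy.
Qed.

End Growth.


(** * From sequences of zeros to products and back *)

Lemma Omega_seq_recip (t : nat -> Rbar) :
  Omega_seq t ->
  (forall j, 0 <= recip (t j)) /\ 0 < recip (t O) /\
  (forall j, recip (t (S j)) <= recip (t j)) /\ ex_series (fun j => recip (t j)).
Proof.
  intros [H0 [Hle [Hinf Hs]]].
  assert (Hpos : forall j, Rbar_lt 0 (t j)).
  { induction j; [easy|]. eapply Rbar_lt_le_trans; [apply IHj|apply Hle]. }
  split; [|split; [|split]]; [| | |easy].
  - intros j. specialize (Hpos j). unfold recip. destruct (t j); simpl in *; try lra.
    now apply Rlt_le, Rinv_0_lt_compat.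
  - unfold recip. destruct (t O); simpl in *; try easy. now apply Rinv_0_lt_compat.
  - intros j. specialize (Hpos j). assert (Hp' := Hpos). specialize (Hle j).
    unfold recip. destruct (t j); destruct (t (S j)); simpl in *; try easy; try lra.
    + now apply Rinv_le_contravar.
    + now apply Rlt_le, Rinv_0_lt_compat.
Qed.

Lemma Omega0_seq_recip (t : nat -> Rbar) (j : nat) :
  Omega0_seq t -> INR (S (S j)) * recip (t (S j)) <= INR (S j) * recip (t j).
Proof.
  intros [Ht H0]. specialize (H0 j).
  assert (P1 : 0 < INR (S j)) by (apply lt_0_INR; lia).
  assert (P2 : 0 < INR (S (S j))) by (apply lt_0_INR; lia).
  assert (Hpos : forall j, Rbar_lt 0 (t j)).
  { destruct Ht as [Hz [Hle _]]. induction j0; [easy|].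
    eapply Rbar_lt_le_trans; [apply IHj0|apply Hle]. }
  destruct (Omega_seq_recip t Ht) as [R0 [_ [Rdec _]]].
  assert (Q1 := Hpos j). assert (Q2 := Hpos (S j)).
  assert (Q3 := R0 j). specialize (Rdec j).
  destruct Ht as [_ [Hle _]]. specialize (Hle j).
  destruct (t (S j)) as [b| |] eqn:Eb.
  - destruct (t j) as [a| |] eqn:Ea; simpl in Hle; try easy.
    cbn -[INR] in H0, Q1, Q2 |- *. unfold recip in *; cbn -[INR] in *.
    apply Rmult_le_reg_r with (a * b * / (INR (S j) * INR (S (S j)))).
    { apply Rmult_lt_0_compat; [nra|]. apply Rinv_0_lt_compat. nra. }
    replace (INR (S (S j)) * / b * (a * b * / (INR (S j) * INR (S (S j)))))
      with (a * / INR (S j)) by (field; lra).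
    replace (INR (S j) * / a * (a * b * / (INR (S j) * INR (S (S j)))))
      with (b * / INR (S (S j))) by (field; lra). easy.
  - replace (recip p_infty) with 0 by reflexivity. rewrite Rmult_0_r.
    apply Rmult_le_pos; lra.
  - easy.
Qed.

Lemma Cmod_Omega_factor (x s : R) : Cmod (1 + Ci * RtoC x * RtoC s)%C = exp (phi (x * s)).
Proof.
  assert (P : 0 < 1 + x * s * (x * s)) by nra.
  assert (E : Cmod (1 + Ci * RtoC x * RtoC s)%C = sqrt (1 + x * s * (x * s))).
  { unfold Cmod. f_equal. simpl. ring. }
  rewrite E. unfold phi. rewrite <- (exp_ln (sqrt _)) by now apply sqrt_lt_R0.
  f_equal. assert (K : ln (sqrt (1 + x * s * (x * s)) * sqrt (1 + x * s * (x * s)))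
    = ln (1 + x * s * (x * s))) by (f_equal; apply sqrt_sqrt; lra).
  rewrite ln_mult in K by now apply sqrt_lt_R0. lra.
Qed.

Lemma Cmod_Omega_Cprod (r : nat -> R) (x : R) (n : nat) :
  Cmod (Cprod (fun j => 1 + Ci * RtoC x * RtoC (r j))%C n)
  = exp (rsum (fun j => phi (x * r j)) n).
Proof.
  induction n; simpl; [rewrite Cmod_1, exp_0; easy|].
  rewrite Cmod_mult, IHn, exp_plus, Cmod_Omega_factor. easy.
Qed.

Lemma is_lim_seq_Cmod (u : nat -> C) (l : C) :
  filterlim u eventually (locally l) -> is_lim_seq (fun n => Cmod (u n)) (Cmod l).
Proof.
  intros H. apply is_lim_seq_spec. intros eps.
  (* Balls in C are products of balls of the components, so radius d only gives [Cmod] < sqrt 2 *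
     d. *)
  assert (S2 : 0 < sqrt 2) by (apply sqrt_lt_R0; lra).
  assert (P : 0 < eps / sqrt 2) by (apply Rdiv_lt_0_compat; [apply cond_pos|easy]).
  destruct (proj1 (filterlim_locally u l) H (mkposreal _ P)) as [N HN].
  exists N. intros n Hn. specialize (HN n Hn).
  assert (K : Cmod (u n - l)%C < sqrt 2 * (eps / sqrt 2))
    by exact (C_NormedModule_mixin_compat2 l (u n) (mkposreal _ P) HN).
  replace (sqrt 2 * (eps / sqrt 2)) with (pos eps) in K by (field; lra).
  generalize (Cmod_rev_triangle (u n) l) (Cmod_rev_triangle l (u n)).
  rewrite (Cmod_minus_sym l). intros. apply Rabs_lt_between. lra.
Qed.

(** On the real line every factor has modulus at least 1, so the moduli of the partial products
    increase to |w(x)|. The limit is thus a supremum, and it is positive, so [ln] and [exp] invert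
    each other here. *)
Lemma Omega_product_growth (t : nat -> Rbar) (w : C -> C) :
  is_Omega_product t w ->
  log_growth (fun j => recip (t j)) (lnabs w) /\
  forall x : R, Cmod (w (RtoC x)) = exp (lnabs w x).
Proof.
  intros Hw.
  assert (L : forall x : R, is_lim_seq (fun n => exp (rsum (fun j => phi (x * recip (t j))) n))
    (Cmod (w (RtoC x)))).
  { intros x. eapply is_lim_seq_ext; [|apply (is_lim_seq_Cmod _ _ (Hw (RtoC x)))].
    intros n. apply (Cmod_Omega_Cprod (fun j => recip (t j))). }
  assert (U : forall x n, exp (rsum (fun j => phi (x * recip (t j))) n) <= Cmod (w (RtoC x))).
  { intros x. apply (is_lim_seq_incr_compare _ _ (L x)). intros n. simpl.
    rewrite exp_plus. generalize (exp_ineq1_le (phi (x * recip (t n)))) (phi_nonneg (x * recip (t n)))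
      (exp_pos (rsum (fun j => phi (x * recip (t j))) n)). nra. }
  assert (P : forall x : R, 0 < Cmod (w (RtoC x))).
  { intros x. eapply Rlt_le_trans; [|apply (U x O)]. apply exp_pos. }
  split; [|intros x; unfold lnabs; now rewrite exp_ln].
  intros x. unfold lnabs. split.
  - intros n. rewrite <- (ln_exp (rsum _ n)). apply ln_le; [apply exp_pos|apply U].
  - intros K HK. rewrite <- (ln_exp K). apply ln_le; [easy|].
    apply (is_lim_seq_le (fun n => exp (rsum (fun j => phi (x * recip (t j))) n))
      (fun _ => exp K) (Cmod (w (RtoC x))) (exp K)).
    + intros n. specialize (HK n). destruct HK as [HK|HK]; [left; now apply exp_increasing|].
      rewrite HK. lra.
    + apply L.
    + apply is_lim_seq_const.
Qed.

Lemma ex_finite_lim_seq_increments (u b : nat -> R) :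
  (forall n, Rabs (u (S n) - u n) <= b n) -> ex_series b -> ex_finite_lim_seq u.
Proof.
  intros H Hb.
  destruct (@ex_series_le R_AbsRing R_CompleteNormedModule (fun n => u (S n) - u n) b H Hb) as [l Hl].
  exists (l + u O). apply is_lim_seq_incr_1.
  apply is_lim_seq_ext with (fun n => sum_n (fun n => u (S n) - u n) n + u O).
  - intros n. induction n; [rewrite sum_O; ring|].
    rewrite sum_Sn. unfold plus; simpl. lra.
  - apply is_lim_seq_plus'; [exact Hl|apply is_lim_seq_const].
Qed.

Lemma Cmod_Cprod_1p_le (a : nat -> C) (n : nat) :
  Cmod (Cprod (fun j => 1 + a j)%C n) <= exp (rsum (fun j => Cmod (a j)) n).
Proof.
  induction n; simpl; [rewrite Cmod_1, exp_0; lra|].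
  rewrite Cmod_mult, exp_plus. apply Rmult_le_compat; try apply Cmod_ge_0; [easy|].
  eapply Rle_trans; [apply Cmod_triangle|]. rewrite Cmod_1. apply exp_ineq1_le.
Qed.

(** Partial products stay below e^M, so their increments are at most e^M |a_n| and both components
    converge absolutely. *)
Lemma Cprod_1p_cv (a : nat -> C) :
  ex_series (fun j => Cmod (a j)) ->
  exists l : C, filterlim (Cprod (fun j => 1 + a j)%C) eventually (locally l).
Proof.
  intros Ha.
  destruct (ex_series_rsum_bounded _ (fun j => Cmod_ge_0 (a j)) Ha) as [M HM].
  set (P := Cprod (fun j => 1 + a j)%C).
  assert (HP : forall n, Cmod (P (S n) - P n)%C <= exp M * Cmod (a n)).
  { intros n. unfold P at 1. simpl. fold (P n).
    replace (P n * (1 + a n) - P n)%C with (P n * a n)%C by ring.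
    rewrite Cmod_mult. apply Rmult_le_compat_r; [apply Cmod_ge_0|].
    eapply Rle_trans; [apply Cmod_Cprod_1p_le|].
    destruct (HM n) as [H|H]; [left; now apply exp_increasing|rewrite H; lra]. }
  assert (Hs : ex_series (fun j => exp M * Cmod (a j)))
    by now apply (@ex_series_scal R_AbsRing R_NormedModule (exp M)).
  destruct (ex_finite_lim_seq_increments (fun n => Re (P n)) (fun j => exp M * Cmod (a j)))
    as [l1 H1]; [|easy|].
  { intros n. eapply Rle_trans; [|apply HP]. apply (re_le_Cmod (P (S n) - P n)%C). }
  destruct (ex_finite_lim_seq_increments (fun n => Im (P n)) (fun j => exp M * Cmod (a j)))
    as [l2 H2]; [|easy|].
  { intros n. eapply Rle_trans; [|apply HP]. apply (Im_le_Cmod (P (S n) - P n)%C). }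
  exists (l1, l2). apply filterlim_locally. intros eps.
  apply is_lim_seq_spec in H1. apply is_lim_seq_spec in H2.
  destruct (H1 eps) as [N1 K1]. destruct (H2 eps) as [N2 K2].
  exists (N1 + N2)%nat. intros n Hn. split.
  - apply (K1 n ltac:(lia)).
  - apply (K2 n ltac:(lia)).
Qed.

Lemma Omega_product_exists (s : nat -> R) :
  (forall j, 0 < s j) -> ex_series (fun j => / s j) ->
  exists w, is_Omega_product (fun j => Finite (s j)) w.
Proof.
  intros Hs Hex.
  assert (H : forall z : C, exists l : C,
    filterlim (Cprod (fun j => (1 + Ci * z * RtoC (recip (Finite (s j))))%C)) eventually (locally l)).
  { intros z. apply Cprod_1p_cv.
    eapply ex_series_ext; [|apply (@ex_series_scal R_AbsRing R_NormedModule (Cmod z)); exact Hex].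
    intros j. unfold scal; simpl. unfold mult; simpl.
    change (recip (Finite (s j))) with (/ s j).
    rewrite !Cmod_mult, Cmod_Ci, Cmod_R. rewrite Rabs_pos_eq; [ring|].
    now apply Rlt_le, Rinv_0_lt_compat. }
  exists (fun z => proj1_sig (constructive_indefinite_description _ (H z))).
  intros z. now destruct (constructive_indefinite_description _ (H z)).
Qed.


(** * The integral hypothesis as a bound on sums *)

(** Lower sums of the integral. The sampling points are left free because the two constructions of
    zeros use different ones: powers of 2 and integers. *)
Lemma mild_sum_bound (r : nat -> R) (w : C -> C) :
  (forall j, 0 <= r j) -> 0 < r O -> (forall j, r (S j) <= r j) -> ex_series r ->
  log_growth r (lnabs w) -> mild_strong_nonquasianalytic w ->
  exists T K : R, 1 <= T /\ forall x : nat -> R,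
    (forall k, T <= x k) -> (forall k, x k <= x (S k)) ->
    forall n, rsum (fun k => Pt (lnabs w) (x k) * (x (S k) - x k) / x (S k) ^ 2) n <= K.
Proof.
  intros Hr Hr0 Hdec Hs HW [l Hl].
  set (W := lnabs w) in *.
  set (g := fun t => W t / t ^ 2 * ln (t / W t)) in *.
  (* Convergence is used only through this: beyond [B] the integrals from 1 exist and lie within 1
     of their limit. *)
  destruct (Hl _ (locally_ball l (mkposreal 1 Rlt_0_1))) as [Q Nb HQ [B HB] Hint].
  specialize (fun b => Hint 1 b HQ). simpl in Hint.
  destruct (growth_little_o r W Hr Hr0 HW (/ 2) Hdec Hs ltac:(lra)) as [T1 [HT1 HT2]].
  (* Two integrals within 1 of [l] differ by less than 2, and replacing ln(1 + t/W) by ln(t/W) costs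
     another factor 2. *)
  set (T := Rmax T1 (B + 1)). exists T, 4.
  assert (A1 : T1 <= T) by apply Rmax_l. assert (A2 : B + 1 <= T) by apply Rmax_r.
  split; [lra|].
  assert (Hex : forall b, T <= b -> ex_RInt g 1 b).
  { intros b Hb. destruct (Hint b (HB b ltac:(lra))) as [y [Hy _]]. now exists y. }
  assert (Hval : forall b, T <= b -> Rabs (RInt g 1 b - l) < 1).
  { intros b Hb. destruct (Hint b (HB b ltac:(lra))) as [y [Hy K]].
    rewrite (is_RInt_unique _ _ _ _ Hy). exact K. }
  assert (Hex' : forall a b, T <= a -> a <= b -> ex_RInt g a b).
  { intros a b Ha Hb. apply ex_RInt_Chasles with 1; [apply ex_RInt_swap|]; apply Hex; lra. }
  assert (Hlow : forall a b, T <= a -> a <= b ->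
    Pt W a * (b - a) / b ^ 2 <= 2 * (RInt g 1 b - RInt g 1 a)).
  { intros a b Ha Hb.
    assert (E : RInt g 1 b = RInt g 1 a + RInt g a b).
    { symmetry. apply (@RInt_Chasles R_CompleteNormedModule); [apply Hex; lra|apply Hex'; lra]. }
    replace (RInt g 1 b - RInt g 1 a) with (RInt g a b : R) by (rewrite E; simpl; lra).
    set (c := Pt W a / (2 * b ^ 2)).
    assert (K : RInt (fun _ => c) a b <= RInt g a b).
    { apply RInt_le; [easy|apply ex_RInt_const|now apply Hex'|].
      intros t Ht. assert (P := growth_pos r W Hr0 HW t ltac:(lra)).
      assert (Hh := HT2 t ltac:(lra)).
      assert (Hy : 2 <= t / W t).
      { apply Rmult_le_reg_r with (W t); [easy|].
        unfold Rdiv. rewrite Rmult_assoc, Rinv_l by lra. lra. }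
      (* For y >= 2 one has 1 + y <= y^2; this is why [T] was chosen with W(t) <= t/2 beyond it. *)
      assert (Hln : ln (1 + t / W t) <= 2 * ln (t / W t)).
      { replace (2 * ln (t / W t)) with (ln (t / W t) + ln (t / W t)) by ring.
        rewrite <- ln_mult by lra. apply ln_le; nra. }
      assert (HP := Pt_mono r W Hr Hr0 HW a t ltac:(lra) ltac:(lra)).
      assert (HP0 := Pt_nonneg r W Hr0 HW a ltac:(lra)).
      assert (Hn : Pt W a <= 2 * (W t * ln (t / W t))).
      { eapply Rle_trans; [apply HP|]. unfold Pt. nra. }
      unfold c, g.
      replace (W t / t ^ 2 * ln (t / W t)) with (2 * (W t * ln (t / W t)) * / (2 * t ^ 2))
        by (field; lra).
      assert (Ht2 : 0 < t ^ 2) by (apply pow_lt; lra).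
      apply Rmult_le_compat; try easy.
      - apply Rlt_le, Rinv_0_lt_compat. assert (0 < b ^ 2) by (apply pow_lt; lra). lra.
      - apply Rinv_le_contravar; [lra|]. apply Rmult_le_compat_l; [lra|]. apply pow_incr; lra. }
    rewrite RInt_const in K. unfold scal in K; simpl in K. unfold mult in K; simpl in K.
    replace (Pt W a * (b - a) / b ^ 2) with (2 * ((b - a) * c)).
    - apply Rmult_le_compat_l; [lra|easy].
    - unfold c. field. lra. }
  intros x HxT Hx n.
  assert (Htel : rsum (fun k => Pt W (x k) * (x (S k) - x k) / x (S k) ^ 2) n
    <= 2 * (RInt g 1 (x n) - RInt g 1 (x O))).
  { induction n; cbn [rsum]; [lra|].
    assert (K := Hlow (x n) (x (S n)) (HxT n) (Hx n)). lra. }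
  assert (V1 := Hval (x n) (HxT n)). assert (V2 := Hval (x O) (HxT O)).
  apply Rabs_lt_between in V1. apply Rabs_lt_between in V2. lra.
Qed.


(** * Zeros at the powers of 2 *)

Section Blocks.

Variable m : nat -> nat.
Hypothesis Hm : forall k, (1 <= m k)%nat.

(** Zeros are listed in blocks, block k consisting of [m k] copies of the same zero; this is the
    first index of block k. *)
Fixpoint block_start (k : nat) : nat :=
  match k with
  | O => O
  | S k => (block_start k + m k)%nat
  end.

(** No block is empty, so passing from j to j + 1 enters at most one new block and a single test is
    enough. *)
Fixpoint block_index (j : nat) : nat :=
  match j with
  | O => O
  | S j => if lt_dec (S j) (block_start (S (block_index j)))
           then block_index j else S (block_index j)
  end.

Lemma block_index_spec (j : nat) :
  (block_start (block_index j) <= j < block_start (S (block_index j)))%nat.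
Proof.
  induction j.
  - simpl. specialize (Hm O). lia.
  - cbn [block_index]. destruct (lt_dec (S j) (block_start (S (block_index j)))) as [H|H].
    + lia.
    + specialize (Hm (S (block_index j))). cbn [block_start] in *. lia.
Qed.

Lemma block_start_mono (k l : nat) : (k <= l)%nat -> (block_start k <= block_start l)%nat.
Proof. induction 1; simpl; lia. Qed.

Lemma block_start_ge (k : nat) : (k <= block_start k)%nat.
Proof. induction k; simpl; [lia|]. specialize (Hm k). lia. Qed.

Lemma block_index_in (k i : nat) : (i < m k)%nat -> block_index (block_start k + i) = k.
Proof.
  intros Hi. destruct (block_index_spec (block_start k + i)) as [H1 H2].
  destruct (lt_eq_lt_dec (block_index (block_start k + i)) k) as [[H|H]|H]; [|easy|].
  - apply (block_start_mono (S _)) in H. lia.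
  - apply (block_start_mono (S _)) in H. simpl in H. lia.
Qed.

Lemma block_index_mono (j : nat) : (block_index j <= block_index (S j))%nat.
Proof. simpl. destruct (lt_dec _ _); lia. Qed.

Lemma rsum_blocks (a : nat -> R) (k : nat) :
  rsum (fun j => a (block_index j)) (block_start k) = rsum (fun i => INR (m i) * a i) k.
Proof.
  induction k; [easy|]. simpl. rewrite rsum_add, IHk. f_equal.
  rewrite <- rsum_const. apply rsum_ext. intros i Hi. now rewrite block_index_in.
Qed.

End Blocks.

Lemma dyadic_bracket (t : R) : 1 <= t -> exists k, 2 ^ k <= t < 2 ^ S k.
Proof.
  intros Ht. destruct (pow2_inv_small t 1) as [n Hn]; [lra|lra|].
  assert (P : 0 < 2 ^ n) by (apply pow_lt; lra).
  assert (H : t < 2 ^ n).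
  { apply Rmult_lt_compat_r with (r := 2 ^ n) in Hn; [|easy].
    replace (t / 2 ^ n * 2 ^ n) with t in Hn by (field; lra). lra. }
  clear Hn P. induction n; [simpl in H; lra|].
  destruct (Rlt_le_dec t (2 ^ n)) as [K|K]; [auto|]. now exists n.
Qed.

Lemma rsum_drop_bound (a : nat -> R) (n0 : nat) (K : R) :
  (forall n, 0 <= a n) -> (forall n, rsum (fun j => a (n0 + j)%nat) n <= K) ->
  forall n, rsum a n <= rsum a n0 + K.
Proof.
  intros Ha HK n. apply Rle_trans with (rsum a (n0 + n)).
  - apply rsum_mono; [easy|lia].
  - rewrite rsum_add. specialize (HK n). lra.
Qed.

Lemma rsum_half_pow (n : nat) : rsum (fun i => / 2 ^ i) n <= 2.
Proof.
  assert (H : rsum (fun i => / 2 ^ i) n = 2 - 2 * / 2 ^ n).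
  { induction n; simpl; [field|]. rewrite IHn. field. apply pow_nonzero. lra. }
  rewrite H. assert (0 < / 2 ^ n) by (apply Rinv_0_lt_compat, pow_lt; lra). lra.
Qed.

Lemma dyadic_sum_bound (P : R -> R) (T K : R) :
  (forall x, 0 < x -> 0 <= P x) ->
  (forall x : nat -> R, (forall k, T <= x k) -> (forall k, x k <= x (S k)) ->
    forall n, rsum (fun k => P (x k) * (x (S k) - x k) / x (S k) ^ 2) n <= K) ->
  exists M, forall n, rsum (fun i => P (2 ^ i) / 2 ^ i) n <= M.
Proof.
  intros HP HK.
  assert (Hpow : forall n, 0 < 2 ^ n) by (intros; apply pow_lt; lra).
  destruct (pow2_inv_small (Rmax T 0) 1) as [n0 Hn0]; [apply Rmax_r|lra|].
  assert (HT : T <= 2 ^ n0).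
  { apply Rmult_lt_compat_r with (r := 2 ^ n0) in Hn0; [|easy].
    replace (Rmax T 0 / 2 ^ n0 * 2 ^ n0) with (Rmax T 0) in Hn0
      by (field; specialize (Hpow n0); lra).
    generalize (Rmax_l T 0). lra. }
  (* For consecutive powers x and 2x the weight (2x - x)/(2x)^2 is 1/(4x), hence the factor 4. *)
  exists (rsum (fun i => P (2 ^ i) / 2 ^ i) n0 + 4 * K). apply rsum_drop_bound.
  { intros n. apply Rmult_le_pos; [apply HP, Hpow|apply Rlt_le, Rinv_0_lt_compat, Hpow]. }
  intros n.
  specialize (HK (fun k => 2 ^ (n0 + k))).
  apply Rle_trans with (4 * rsum (fun k => P (2 ^ (n0 + k)) * (2 ^ (n0 + S k) - 2 ^ (n0 + k))
    / (2 ^ (n0 + S k)) ^ 2) n).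
  - rewrite <- rsum_scal. apply rsum_le. intros j _. rewrite Nat.add_succ_r.
    change (2 ^ S (n0 + j)) with (2 * 2 ^ (n0 + j)). specialize (Hpow (n0 + j)%nat).
    right. field. lra.
  - apply Rmult_le_compat_l; [lra|]. apply HK.
    + intros k. eapply Rle_trans; [apply HT|]. apply Rle_pow; [lra|lia].
    + intros k. apply Rle_pow; [lra|lia].
Qed.

(** The zero 2^k has multiplicity about P(2^(k+1)). For 2^k <= t < 2^(k+1) each copy contributes at
    least phi(1) >= 1/4, so this one block already yields P(2^(k+1))/4 >= P(t)/4. *)
Lemma Omega_majorant_sequence (P : R -> R) :
  (forall x, 0 < x -> 0 <= P x) -> (forall x y, 0 < x -> x <= y -> P x <= P y) ->
  (exists M, forall n, rsum (fun i => P (2 ^ i) / 2 ^ i) n <= M) ->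
  exists s : nat -> R, (forall j, 0 < s j) /\ (forall j, s j <= s (S j)) /\
    ex_series (fun j => / s j) /\
    forall t, 1 <= t -> exists n, / 4 * P t <= rsum (fun j => phi (t * / s j)) n.
Proof.
  intros HP Hmono [M HM].
  assert (Hpow : forall n, 0 < 2 ^ n) by (intros; apply pow_lt; lra).
  (* Floor plus one: it dominates P(2^(k+1)) and makes every block nonempty; the excess adds at most
     the sum of 2^(-k) to the reciprocal series. *)
  set (m := fun k => S (proj1_sig (nfloor_ex (P (2 ^ S k)) (HP _ (Hpow (S k)))))).
  assert (Hm : forall k, P (2 ^ S k) <= INR (m k) <= P (2 ^ S k) + 1).
  { intros k. unfold m. destruct (nfloor_ex _ _) as [n Hn]. rewrite S_INR. simpl proj1_sig. lra. }
  assert (Hm1 : forall k, (1 <= m k)%nat) by (intros; unfold m; lia).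
  exists (fun j => 2 ^ block_index m j). split; [|split; [|split]].
  - intros j. apply Hpow.
  - intros j. apply Rle_pow; [lra|]. now apply block_index_mono.
  - apply rsum_bounded_ex_series with (2 * M + 2).
    { intros j. apply Rlt_le, Rinv_0_lt_compat, Hpow. }
    intros n. apply Rle_trans with (rsum (fun j => / 2 ^ block_index m j) (block_start m n)).
    { apply rsum_mono; [|now apply block_start_ge].
      intros j. apply Rlt_le, Rinv_0_lt_compat, Hpow. }
    rewrite (rsum_blocks m Hm1 (fun i => / 2 ^ i)).
    apply Rle_trans with (rsum (fun i => 2 * (P (2 ^ (1 + i)) / 2 ^ (1 + i)) + / 2 ^ i) n).
    + apply rsum_le. intros j _. specialize (Hm j). assert (Hpj := Hpow j).
      replace (2 * (P (2 ^ (1 + j)) / 2 ^ (1 + j)) + / 2 ^ j) with ((P (2 ^ S j) + 1) * / 2 ^ j)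
        by (simpl; field; lra).
      apply Rmult_le_compat_r; [apply Rlt_le, Rinv_0_lt_compat; lra|easy].
    + rewrite rsum_plus, rsum_scal. generalize (rsum_half_pow n). specialize (HM (1 + n)%nat).
      rewrite (rsum_add _ 1 n) in HM.
      assert (0 <= rsum (fun i => P (2 ^ i) / 2 ^ i) 1); [|lra].
      apply rsum_nonneg. intros j. apply Rmult_le_pos; [apply HP, Hpow|].
      apply Rlt_le, Rinv_0_lt_compat, Hpow.
  - intros t Ht. destruct (dyadic_bracket t Ht) as [k [Hk1 Hk2]].
    exists (block_start m (S k)). simpl. rewrite rsum_add.
    assert (H0 : 0 <= rsum (fun j => phi (t * / 2 ^ block_index m j)) (block_start m k))
      by (apply rsum_nonneg; intros; apply phi_nonneg).
    assert (H1 : INR (m k) * / 4 <=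
      rsum (fun j => phi (t * / 2 ^ block_index m (block_start m k + j))) (m k)).
    { rewrite <- rsum_const. apply rsum_le. intros i Hi. rewrite block_index_in by easy.
      apply phi_ge_1. assert (Hpk := Hpow k). apply Rmult_le_reg_r with (2 ^ k); [easy|].
      rewrite Rmult_assoc, Rinv_l by lra. lra. }
    assert (H2 : P t <= P (2 ^ S k)) by (apply Hmono; lra).
    specialize (Hm k). lra.
Qed.

(** * Zeros with nondecreasing ratios *)

Lemma ln_pow_fact_le (n : nat) : INR n * ln (INR n) - rsum (fun j => ln (INR (S j))) n <= 2 * INR n.
Proof.
  destruct n; [simpl; lra|].
  assert (F : forall k, rsum (fun j => ln (INR (S j))) k = ln (INR (Factorial.fact k))).
  { induction k; [simpl; now rewrite ln_1|].
    cbn [rsum]. rewrite IHk, fact_simpl, mult_INR, ln_mult; [ring| |apply INR_fact_pos].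
    apply lt_0_INR; lia. }
  rewrite F. assert (P : 0 < INR (S n)) by (apply lt_0_INR; lia).
  assert (H := pow_le_pow3_fact (S n)). apply ln_le in H; [|now apply pow_lt].
  rewrite ln_mult in H; [|apply pow_lt; lra|apply INR_fact_pos].
  rewrite !ln_pow in H by lra.
  assert (L3 : ln 3 <= 2). { generalize (ln_1p_le 2). replace (1 + 2) with 3 by ring. lra. }
  nra.
Qed.

Section RegularGrowth.

Variables (r : nat -> R) (W : R -> R).
Hypothesis Hr : forall j, 0 <= r j.
Hypothesis Hr0 : 0 < r O.
Hypothesis HW : log_growth r W.
Hypothesis Hreg : forall j, INR (S (S j)) * r (S j) <= INR (S j) * r j.

Lemma regular_mono (i k : nat) : (i <= k)%nat -> INR (S k) * r k <= INR (S i) * r i.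
Proof. induction 1; [lra|]. eapply Rle_trans; [apply Hreg|easy]. Qed.

(* Regularity gives [n r_j <= r_q] for all [j] in the block
   [[(q + 1) n, (q + 2) n)]; Stirling handles the first block. *)
Lemma growth_scale_regular (n : nat) (x : R) :
  (1 <= n)%nat -> 1 <= x -> W (INR n * x) <= INR n * ((2 + 2 / W 1) * W x).
Proof.
  intros Hn Hx.
  assert (Pn : 1 <= INR n) by (change 1 with (INR 1); apply le_INR; lia).
  assert (W1 := growth_pos r W Hr0 HW 1 ltac:(lra)).
  assert (Wx : W 1 <= W x) by (apply (growth_mono r W Hr HW); lra).
  apply (proj2 (HW (INR n * x))). intros N.
  assert (Hblock : forall Q : nat, rsum (fun j => phi (INR n * x * r j)) (n + Q * n)
    <= rsum (fun j => phi (INR n * x * r j)) n + INR n * rsum (fun q => phi (x * r q)) Q).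
  { induction Q; [rewrite Nat.add_0_r; simpl; lra|].
    replace (n + S Q * n)%nat with (n + Q * n + n)%nat by lia. rewrite rsum_add.
    assert (K : rsum (fun j => phi (INR n * x * r (n + Q * n + j)%nat)) n <= INR n * phi (x * r Q)).
    { rewrite <- (rsum_const (phi (x * r Q))). apply rsum_le. intros j _. apply phi_mono.
      - repeat apply Rmult_le_pos; auto; lra.
      - rewrite (Rmult_comm (INR n)), Rmult_assoc. apply Rmult_le_compat_l; [lra|].
        assert (D := regular_mono Q (n + Q * n + j) ltac:(nia)).
        assert (PQ : 0 < INR (S Q)) by (apply lt_0_INR; lia).
        assert (E : INR n * INR (S Q) <= INR (S (n + Q * n + j))).
        { rewrite <- mult_INR. apply le_INR. nia. }
        apply Rmult_le_reg_l with (INR (S Q)); [easy|].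
        eapply Rle_trans; [|apply D]. rewrite <- Rmult_assoc, (Rmult_comm (INR (S Q))).
        apply Rmult_le_compat_r; auto. }
    cbn [rsum]. lra. }
  (* In the first block r_j <= r_0/(j + 1), so the scale n costs a factor y = n/(j + 1) >= 1 and
     phi(y v) <= ln y + phi(v). The sum of the ln y is ln(n^n/n!) <= 2n. *)
  assert (Hfirst : rsum (fun j => phi (INR n * x * r j)) n <= 2 * INR n + INR n * phi (x * r O)).
  { apply Rle_trans with (rsum (fun j => (ln (INR n) + phi (x * r O)) + (-1) * ln (INR (S j))) n).
    - apply rsum_le. intros j Hj.
      assert (Pj : 1 <= INR (S j)) by (change 1 with (INR 1); apply le_INR; lia).
      assert (D := regular_mono 0 j ltac:(lia)). change (INR 1) with 1 in D. rewrite Rmult_1_l in D.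
      set (y := INR n / INR (S j)).
      assert (Py : 1 <= y).
      { unfold y. apply Rmult_le_reg_r with (INR (S j)); [lra|].
        unfold Rdiv. rewrite Rmult_assoc, Rinv_l, Rmult_1_r, Rmult_1_l by lra. apply le_INR. lia. }
      replace (ln (INR n) + phi (x * r O) + -1 * ln (INR (S j))) with (ln y + phi (x * r O))
        by (unfold y; rewrite ln_div by lra; ring).
      apply Rle_trans with (phi (y * (x * r O))).
      + apply phi_mono; [repeat apply Rmult_le_pos; auto; lra|].
        unfold y. apply Rmult_le_reg_r with (INR (S j)); [lra|].
        replace (INR n / INR (S j) * (x * r O) * INR (S j)) with (INR n * x * r O) by (field; lra).
        rewrite Rmult_assoc, (Rmult_comm (r j)). apply Rmult_le_compat_l; [nra|easy].
      + unfold phi. set (v := x * r O).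
        assert (K : ln (1 + y * v * (y * v)) <= ln (y * y * (1 + v * v))).
        { apply ln_le; nra. }
        rewrite !ln_mult in K by nra. lra.
    - rewrite rsum_plus, rsum_const, rsum_scal. generalize (ln_pow_fact_le n). lra. }
  eapply Rle_trans.
  - apply (rsum_mono _ N (n + N * n)); [intros; apply phi_nonneg|nia].
  - eapply Rle_trans; [apply Hblock|].
    assert (K1 := proj1 (HW x) N).
    assert (K2 := proj1 (HW x) 1%nat). simpl in K2. rewrite Rplus_0_l in K2.
    (* The additive 2n of the first block is absorbed through W(x) >= W(1); this is the origin of 2
       / W(1). *)
    assert (K3 : 2 <= 2 / W 1 * W x).
    { replace 2 with (2 / W 1 * W 1) at 1 by (field; lra).
      apply Rmult_le_compat_l; [|easy]. apply Rlt_le, Rdiv_lt_0_compat; lra. }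
    apply Rle_trans with (INR n * (2 + phi (x * r O) + rsum (fun q => phi (x * r q)) N)); [lra|].
    apply Rmult_le_compat_l; [lra|]. lra.
Qed.

Fixpoint min_slope (j : nat) : R :=
  match j with
  | O => W 1
  | S i => Rmin (min_slope i) (W (INR (S j)) / INR (S j))
  end.

Lemma min_slope_le (j : nat) : min_slope j <= W (INR (S j)) / INR (S j).
Proof. destruct j; [simpl; right; field|]. cbn [min_slope]. apply Rmin_r. Qed.

Lemma min_slope_dec (i j : nat) : (i <= j)%nat -> min_slope j <= min_slope i.
Proof. induction 1; [lra|]. eapply Rle_trans; [apply Rmin_l|easy]. Qed.

Lemma min_slope_ge (j : nat) (K : R) :
  (forall i, (i <= j)%nat -> K <= W (INR (S i)) / INR (S i)) -> K <= min_slope j.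
Proof.
  induction j; intros H.
  - specialize (H O ltac:(lia)). change (INR 1) with 1 in H. simpl. lra.
  - cbn [min_slope]. apply Rmin_glb; [apply IHj; intros; apply H; lia|apply H; lia].
Qed.

Lemma min_slope_pos (j : nat) : 0 < min_slope j.
Proof.
  induction j; [apply (growth_pos r W Hr0 HW); lra|].
  cbn [min_slope]. apply Rmin_pos; [easy|].
  assert (0 < INR (S (S j))) by (apply lt_0_INR; lia).
  apply Rdiv_lt_0_compat; [|easy]. now apply (growth_pos r W Hr0 HW).
Qed.

(** The constant of [growth_scale_regular], doubled to pay for rounding a ratio of integers up to an
    integer. *)
Definition slope_const : R := 2 * (2 + 2 / W 1).

Lemma slope_const_ge_1 : 1 <= slope_const.
Proof.
  unfold slope_const. assert (W1 := growth_pos r W Hr0 HW 1 ltac:(lra)).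
  assert (0 < 2 / W 1) by (apply Rdiv_lt_0_compat; lra). lra.
Qed.

(** The slopes are almost decreasing: a later slope exceeds an earlier one by at most the factor
    [slope_const]. So the running minimum loses only this factor. *)
Lemma min_slope_almost (j : nat) :
  W (INR (S j)) / INR (S j) / slope_const <= min_slope j.
Proof.
  assert (W1 := growth_pos r W Hr0 HW 1 ltac:(lra)).
  assert (HC := slope_const_ge_1).
  apply min_slope_ge. intros i Hi.
  (* The quotient rounded up: n (i + 1) lies between j + 1 and 2 (j + 1), because i <= j. *)
  set (n := S (Nat.div j (S i))).
  assert (Hn : (S j <= n * S i)%nat /\ (n * S i <= 2 * S j)%nat).
  { unfold n. assert (D := Nat.div_mod j (S i) ltac:(lia)).
    assert (D2 := Nat.mod_upper_bound j (S i) ltac:(lia)). nia. }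
  destruct Hn as [Hn1 Hn2]. apply le_INR in Hn1. apply le_INR in Hn2.
  rewrite mult_INR in Hn1, Hn2. rewrite mult_INR in Hn2. change (INR 2) with 2 in Hn2.
  assert (Pi : 1 <= INR (S i)) by (change 1 with (INR 1); apply le_INR; lia).
  assert (Pj : 1 <= INR (S j)) by (change 1 with (INR 1); apply le_INR; lia).
  assert (Pn : 1 <= INR n) by (change 1 with (INR 1); apply le_INR; unfold n; lia).
  assert (K := growth_scale_regular n (INR (S i)) ltac:(unfold n; lia) Pi).
  assert (K2 : W (INR (S j)) <= W (INR n * INR (S i))) by (apply (growth_mono r W Hr HW); lra).
  assert (P := growth_pos r W Hr0 HW (INR (S i)) ltac:(lra)).
  assert (C2 : 2 + 2 / W 1 = slope_const / 2) by (unfold slope_const; field; lra).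
  rewrite C2 in K.
  apply Rmult_le_reg_r with (INR (S j) * slope_const * INR (S i)).
  { repeat apply Rmult_lt_0_compat; lra. }
  replace (W (INR (S j)) / INR (S j) / slope_const * (INR (S j) * slope_const * INR (S i)))
    with (W (INR (S j)) * INR (S i)) by (field; lra).
  replace (W (INR (S i)) / INR (S i) * (INR (S j) * slope_const * INR (S i)))
    with (W (INR (S i)) * slope_const * INR (S j)) by (field; lra).
  apply Rle_trans with (INR n * (slope_const / 2 * W (INR (S i))) * INR (S i)).
  - apply Rmult_le_compat_r; lra.
  - replace (INR n * (slope_const / 2 * W (INR (S i))) * INR (S i))
      with (slope_const / 2 * W (INR (S i)) * (INR n * INR (S i))) by ring.
    replace (W (INR (S i)) * slope_const * INR (S j))
      with (slope_const / 2 * W (INR (S i)) * (2 * INR (S j))) by field.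
    apply Rmult_le_compat_l; [nra|easy].
Qed.

Definition zero_density (j : nat) : R := min_slope j * ln (1 + 1 / min_slope j).

Lemma zero_density_bounds (j : nat) : 0 < zero_density j <= 1.
Proof.
  unfold zero_density. assert (P := min_slope_pos j).
  assert (0 < 1 / min_slope j) by (apply Rdiv_lt_0_compat; lra).
  assert (L : ln 1 < ln (1 + 1 / min_slope j)) by (apply ln_increasing; lra).
  rewrite ln_1 in L. split; [nra|].
  apply Rle_trans with (min_slope j * (1 / min_slope j)); [|right; field; lra].
  apply Rmult_le_compat_l; [lra|]. apply ln_1p_le. lra.
Qed.

Lemma zero_density_dec (i j : nat) : (i <= j)%nat -> zero_density j <= zero_density i.
Proof.
  intros H. apply x_ln_1p_inv_mono; [lra|apply min_slope_pos|now apply min_slope_dec].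
Qed.

(** Gives convergence of the reciprocal zeros, by comparison with [Pt W](j + 1) / (j + 1)^2. *)
Lemma zero_density_le_Pt (j : nat) : zero_density j <= Pt W (INR (S j)) / INR (S j).
Proof.
  assert (Pj : 0 < INR (S j)) by (apply lt_0_INR; lia).
  assert (P := growth_pos r W Hr0 HW _ Pj).
  apply Rle_trans with (W (INR (S j)) / INR (S j) * ln (1 + 1 / (W (INR (S j)) / INR (S j)))).
  - apply x_ln_1p_inv_mono; [lra|apply min_slope_pos|apply min_slope_le].
  - right. unfold Pt. replace (1 / (W (INR (S j)) / INR (S j))) with (INR (S j) / W (INR (S j)))
      by (field; lra). field. lra.
Qed.

(** Gives the domination by [rho]. Shrinking the slope by [slope_const] only enlarges the logarithm,
    so nothing beyond that factor is lost. *)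
Lemma zero_density_ge_Pt (j : nat) : Pt W (INR (S j)) / INR (S j) / slope_const <= zero_density j.
Proof.
  assert (Pj : 0 < INR (S j)) by (apply lt_0_INR; lia).
  assert (P := growth_pos r W Hr0 HW _ Pj). assert (HC := slope_const_ge_1).
  set (x := W (INR (S j)) / INR (S j)).
  assert (Px : 0 < x) by now apply Rdiv_lt_0_compat.
  assert (Pxc : 0 < x / slope_const) by (apply Rdiv_lt_0_compat; lra).
  apply Rle_trans with (x / slope_const * ln (1 + 1 / (x / slope_const))).
  - unfold Pt. replace (INR (S j) / W (INR (S j))) with (1 / x) by (unfold x; field; lra).
    replace (W (INR (S j)) * ln (1 + 1 / x) / INR (S j) / slope_const)
      with (x / slope_const * ln (1 + 1 / x)) by (unfold x; field; lra).
    apply Rmult_le_compat_l; [lra|].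
    assert (0 < 1 / x) by (apply Rdiv_lt_0_compat; lra).
    apply ln_le; [lra|]. replace (1 / (x / slope_const)) with (1 / x * slope_const)
      by (field; lra). nra.
  - apply x_ln_1p_inv_mono; [lra|easy|apply min_slope_almost].
Qed.

Lemma Omega0_majorant_sequence (T K : R) :
  (forall x : nat -> R, (forall k, T <= x k) -> (forall k, x k <= x (S k)) ->
    forall n, rsum (fun k => Pt W (x k) * (x (S k) - x k) / x (S k) ^ 2) n <= K) ->
  exists s : nat -> R, (forall j, 0 < s j) /\
    (forall j, s j / INR (S j) <= s (S j) / INR (S (S j))) /\
    ex_series (fun j => / s j) /\
    forall t, 1 <= t -> exists n,
      / (16 * slope_const) * Pt W t - / 4 <= rsum (fun j => phi (t * / s j)) n.
Proof.
  intros HK.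
  assert (PS : forall j, 1 <= INR (S j)) by (intros; change 1 with (INR 1); apply le_INR; lia).
  exists (fun j => INR (S j) / zero_density j). split; [|split; [|split]].
  - intros j. apply Rdiv_lt_0_compat; [|apply zero_density_bounds]. specialize (PS j). lra.
  - intros j. assert (P1 := PS j). assert (P2 := PS (S j)).
    assert (G1 := zero_density_bounds j). assert (G2 := zero_density_bounds (S j)).
    assert (G3 := zero_density_dec j (S j) ltac:(lia)).
    replace (INR (S j) / zero_density j / INR (S j)) with (/ zero_density j) by (field; lra).
    replace (INR (S (S j)) / zero_density (S j) / INR (S (S j))) with (/ zero_density (S j)) by (field; lra).
    apply Rinv_le_contravar; lra.
  - set (a := fun j => / (INR (S j) / zero_density j)).
    assert (Ha : forall j, 0 <= a j).
    { intros j. apply Rlt_le, Rinv_0_lt_compat, Rdiv_lt_0_compat; [|apply zero_density_bounds].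
      specialize (PS j). lra. }
    destruct (nfloor_ex (Rmax T 0) (Rmax_r _ _)) as [n0 Hn0].
    (* The sampling points are the integers y beyond [T]; the factor 4 comes from (y + 1)^2 <= 4
       y^2. *)
    apply rsum_bounded_ex_series with (rsum a n0 + 4 * K); [easy|].
    apply rsum_drop_bound; [easy|]. intros n.
    specialize (HK (fun k => INR (S (n0 + k)))).
    eapply Rle_trans; [|apply Rmult_le_compat_l; [lra|apply (HK) with (n := n)]].
    + rewrite <- rsum_scal. apply rsum_le. intros j _. rewrite Nat.add_succ_r.
      unfold a. set (i := (n0 + j)%nat). assert (P1 := PS i). rewrite (S_INR (S i)).
      assert (G1 := zero_density_bounds i). assert (G2 := zero_density_le_Pt i).
      assert (Pp := Pt_nonneg r W Hr0 HW (INR (S i)) ltac:(lra)).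
      set (y := INR (S i)) in *.
      replace (/ (y / zero_density i)) with (zero_density i * / y) by (field; lra).
      apply Rle_trans with (Pt W y / y * / y).
      { apply Rmult_le_compat_r; [apply Rlt_le, Rinv_0_lt_compat; lra|easy]. }
      replace (Pt W y / y * / y) with (Pt W y * / (y * y)) by (field; lra).
      replace (4 * (Pt W y * (y + 1 - y) / (y + 1) ^ 2)) with
        (Pt W y * / (((y + 1) * (y + 1)) / 4)) by (field; lra).
      apply Rmult_le_compat_l; [easy|]. apply Rinv_le_contravar; nra.
    + intros k. rewrite S_INR, plus_INR. generalize (Rmax_l T 0) (pos_INR k). lra.
    + intros k. apply le_INR. lia.
  - intros t Ht.
    destruct (nfloor_ex t ltac:(lra)) as [j0 Hj0].
    assert (G := zero_density_bounds j0).
    (* At least [n] zeros are <= t: for j < n one has n <= j0, as the density is at most 1, and the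
       density at j is no smaller than at j0. Each gives at least 1/4, and rounding down to [n]
       costs the constant 1/4. *)
    destruct (nfloor_ex (t * zero_density j0) ltac:(nra)) as [n Hn].
    assert (Hnj : (n <= j0)%nat).
    { assert (INR n < INR (S j0)) by (rewrite S_INR; nra). apply INR_lt in H. lia. }
    exists n. apply Rle_trans with (INR n * / 4).
    + assert (HC := slope_const_ge_1).
      assert (P0 := PS j0). assert (Ei := S_INR j0).
      assert (Q1 := zero_density_ge_Pt j0).
      assert (Q2 := Pt_mono r W Hr Hr0 HW t (INR (S j0)) ltac:(lra) ltac:(lra)).
      assert (Q3 := Pt_nonneg r W Hr0 HW (INR (S j0)) ltac:(lra)).
      assert (Q4 : Pt W (INR (S j0)) / (4 * slope_const) <= t * zero_density j0).
      { apply Rle_trans with (INR (S j0) / 2 * zero_density j0); [|apply Rmult_le_compat_r; lra].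
        apply Rle_trans with (INR (S j0) / 2 * (Pt W (INR (S j0)) / INR (S j0) / slope_const)).
        - replace (INR (S j0) / 2 * (Pt W (INR (S j0)) / INR (S j0) / slope_const)) with
            (Pt W (INR (S j0)) / (4 * slope_const) * 2) by (field; lra).
          assert (0 <= Pt W (INR (S j0)) / (4 * slope_const)); [|lra].
          apply Rmult_le_pos; [easy|apply Rlt_le, Rinv_0_lt_compat; lra].
        - apply Rmult_le_compat_l; lra. }
      assert (Q5 : / (16 * slope_const) * Pt W t <= Pt W (INR (S j0)) / (4 * slope_const) / 4).
      { replace (Pt W (INR (S j0)) / (4 * slope_const) / 4) with
          (/ (16 * slope_const) * Pt W (INR (S j0))) by (field; lra).
        apply Rmult_le_compat_l; [apply Rlt_le, Rinv_0_lt_compat; lra|easy]. }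
      lra.
    + rewrite <- rsum_const. apply rsum_le. intros j Hj. apply phi_ge_1.
      assert (G1 := zero_density_bounds j). assert (G2 := zero_density_dec j j0 ltac:(lia)).
      assert (P1 := PS j). assert (Hj' : INR (S j) <= INR n) by (apply le_INR; lia).
      replace (t * / (INR (S j) / zero_density j)) with (t * zero_density j / INR (S j)) by (field; lra).
      apply Rmult_le_reg_r with (INR (S j)); [lra|].
      unfold Rdiv. rewrite Rmult_assoc, Rinv_l by lra. nra.
Qed.

End RegularGrowth.


(** * The lower bound for entire functions *)

(** By continuity a short vertical displacement keeps f nonzero. *)
Lemma nonzero_off_axis (f : C -> C) (z : C) :
  ccont f z -> f z <> 0%C -> exists z0, Im z0 <> 0 /\ f z0 <> 0%C.
Proof.
  intros Hc Hz. destruct (Req_dec (Im z) 0) as [E|N]; [|now exists z].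
  assert (P : 0 < Cmod (f z)) by now apply Cmod_gt_0.
  destruct (Hc (Cmod (f z) / 2) ltac:(lra)) as [d [Hd K]].
  exists (z + Ci * RtoC (d / 2))%C. split.
  - destruct z as [x y]. simpl in *. lra.
  - specialize (K (z + Ci * RtoC (d / 2))%C).
    replace (z + Ci * RtoC (d / 2) - z)%C with (Ci * RtoC (d / 2))%C in K by ring.
    rewrite Cmod_mult, Cmod_Ci, Cmod_R, Rabs_pos_eq in K by lra. specialize (K ltac:(lra)).
    intros E0. rewrite E0 in K. rewrite Cmod_minus_sym in K.
    replace (f z - 0)%C with (f z) in K by ring. lra.
Qed.

Lemma Cmod_Cpow_exp (z : C) (x : R) (n : nat) :
  Cmod z = exp x -> Cmod (Cpow z n) = exp (INR n * x).
Proof.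
  intros H. rewrite Cmod_pow, H. induction n; [simpl; now rewrite Rmult_0_l, exp_0|].
  rewrite S_INR. simpl. rewrite IHn, <- exp_plus. f_equal. ring.
Qed.

Lemma Rbar_le_lub (E : Rbar -> Prop) (x : Rbar) : E x -> Rbar_le x (Rbar_lub E).
Proof. exact (proj1 (proj2_sig (Rbar_ex_lub E)) x). Qed.

Section Majorant.

Variables (r : nat -> R) (w : C -> C).
Hypothesis Hr : forall j, 0 <= r j.
Hypothesis Hr0 : 0 < r O.
Hypothesis Hdec : forall j, r (S j) <= r j.
Hypothesis Hs : ex_series r.
Hypothesis HW : log_growth r (lnabs w).
Hypothesis Hexp : forall x : R, Cmod (w (RtoC x)) = exp (lnabs w x).

Lemma growth_ratio_bound : exists L, 0 < L /\ forall x, 0 <= x -> lnabs w x <= L * x.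
Proof.
  destruct (ex_series_rsum_bounded r Hr Hs) as [M HM].
  exists (M + 1). assert (M0 := HM O). simpl in M0. split; [lra|]. intros x Hx.
  assert (K := growth_linear r (lnabs w) Hr HW M x HM Hx). nra.
Qed.

(** The interpolation estimate on [t, t + W(tau)] with tau = |t| + 1. The shift by 1 keeps W(tau) >=
    W(1) > 0, so constants can be absorbed into multiples of W(tau). *)
Lemma local_lower_bound (f : C -> C) (n0 : nat) (d0 : R) :
  entire f -> (exists z, f z <> 0%C) -> 0 < d0 ->
  (forall z, Cmod (f z) <= d0 * Cmod (Cpow (w (RtoC (Cmod z))) n0)) ->
  exists a b, 0 < a /\ 0 < b /\ forall t, exists s,
    Rabs (s - t) <= a * Pt (lnabs w) (Rabs t + 1) /\
    exp (- (a * Pt (lnabs w) (Rabs t + 1) + b)) <= Cmod (f (RtoC s)).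
Proof.
  intros Hf [z1 Hz1] Hd0 Hbound.
  assert (Hcd : forall z, exists l, has_cderiv f z l) by (intros; now apply entire_has_cderiv).
  destruct (Hcd z1) as [l1 Hl1].
  destruct (nonzero_off_axis f z1 (has_cderiv_cont _ _ _ Hl1) Hz1) as [z0 [Hz0 Hfz0]].
  clear z1 Hz1 l1 Hl1.
  destruct growth_ratio_bound as [L [HL Hlin]].
  set (W := lnabs w) in *.
  set (F := Cmod (f z0)). assert (HF : 0 < F) by now apply Cmod_gt_0.
  set (eta := Rabs (Im z0)). assert (Heta : 0 < eta) by now apply Rabs_pos_lt.
  assert (Hm0 := Cmod_ge_0 z0).
  (* Chosen so that the radius B = |t| + W(tau) + |z0| is at most K tau. *)
  set (K := 1 + L + Cmod z0). assert (HK : 1 <= K) by (unfold K; lra).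
  set (w1 := W 1). assert (Hw1 : 0 < w1) by (apply (growth_pos r W Hr0 HW); lra).
  assert (Hn0 := pos_INR n0).
  set (La := Rmax 0 (ln (2 * d0 / F))).
  assert (HLa : 0 <= La) by apply Rmax_l.
  assert (HLa' : ln (2 * d0 / F) <= La) by apply Rmax_r.
  (* Makes the degree satisfy m <= a1 W(tau). The three terms pay for ln(2 d0/F), for the growth
     bound on the large disc, and for rounding up to an integer. *)
  set (a1 := 2 * La / w1 + 72 * K * K * INR n0 + 1 / w1).
  assert (Ha1 : 0 < a1).
  { unfold a1. assert (0 <= 2 * La / w1) by (apply Rmult_le_pos; [lra|apply Rlt_le, Rinv_0_lt_compat; lra]).
    assert (0 < 1 / w1) by (apply Rdiv_lt_0_compat; lra).
    assert (0 <= 72 * K * K * INR n0) by (repeat apply Rmult_le_pos; lra). lra. }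
  set (q := ln (1 + / L)).
  assert (Hq : 0 < q).
  { unfold q. rewrite <- ln_1. assert (0 < / L) by now apply Rinv_0_lt_compat.
    apply ln_increasing; lra. }
  (* Makes ln(12 B/l) <= b1 ln(1 + tau/l): [q] bounds the right-hand logarithm from below and so
     absorbs the constant ln(12 K). *)
  set (b1 := ln (12 * K) / q + 1).
  assert (Hlk : 0 <= ln (12 * K)) by (apply ln_nonneg; lra).
  assert (Hb1 : 1 <= b1).
  { unfold b1. assert (0 <= ln (12 * K) / q); [|lra].
    apply Rmult_le_pos; [easy|apply Rlt_le, Rinv_0_lt_compat; lra]. }
  set (c1 := - ln eta - ln (F / 2)).
  (* With y = ln(12 B/l) the interpolation bound reads A <= ln B + m y + c1, and ln B <= y + l <= m
     y + l. Here m y <= a1 b1 P and l <= P/q, whence the coefficient; the 1 added to |c1| makes the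
     contradiction strict. *)
  exists (2 * a1 * b1 + / q), (Rabs c1 + 1).
  assert (Hiq : 0 < / q) by now apply Rinv_0_lt_compat.
  assert (Hab : 0 < a1 * b1) by (apply Rmult_lt_0_compat; lra).
  split; [lra|]. split; [generalize (Rabs_pos c1); lra|].
  intros t. set (tau := Rabs t + 1).
  assert (Ht := Rabs_pos t). assert (Htau : 1 <= tau) by (unfold tau; lra).
  set (l := W tau).
  assert (Hl : w1 <= l) by (apply (growth_mono r W Hr HW); lra).
  assert (Hl0 : 0 < l) by lra.
  assert (HlL : l <= L * tau) by (apply Hlin; lra).
  set (P := Pt W tau).
  assert (HPq : q * l <= P) by (apply (Pt_ge_growth r W Hr0 HW); [lra|lra|exact HlL]).
  assert (HP0 : 0 < P) by (eapply Rlt_le_trans; [|apply HPq]; now apply Rmult_lt_0_compat).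
  assert (HlP : l <= / q * P).
  { apply Rmult_le_reg_l with q; [easy|]. rewrite <- Rmult_assoc, Rinv_r by lra. lra. }
  set (B := Rabs t + l + Cmod z0).
  assert (HB0 : 0 < B) by (unfold B; lra).
  assert (HB : B <= K * tau).
  { unfold B, K. assert (0 <= Cmod z0 * Rabs t) by now apply Rmult_le_pos.
    unfold tau in *. lra. }
  set (M := d0 * exp (INR n0 * (36 * K * K * l))).
  assert (HM : forall z, Cmod z <= 6 * B -> Cmod (f z) <= M).
  { intros z Hz. eapply Rle_trans; [apply Hbound|].
    rewrite (Cmod_Cpow_exp _ _ n0 (Hexp (Cmod z))). apply Rmult_le_compat_l; [lra|].
    assert (E : INR n0 * W (Cmod z) <= INR n0 * (36 * K * K * l)).
    { apply Rmult_le_compat_l; [easy|].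
      apply Rle_trans with (W (6 * K * tau)).
      - apply (growth_mono r W Hr HW); [apply Cmod_ge_0|lra].
      - eapply Rle_trans; [apply (growth_scale r W HW); lra|]. right. unfold l. ring. }
    destruct E as [E|E]; [left; now apply exp_increasing|rewrite E; lra]. }
  (* As ln 2 > 1/2, a degree m >= v gives 2^m >= 2M/F, so the error term takes at most half of
     |f(z0)|. *)
  set (v := 2 * (La + 36 * K * K * INR n0 * l)).
  assert (Hkk : 0 <= 36 * K * K * INR n0 * l) by (repeat apply Rmult_le_pos; lra).
  assert (Hv : 0 <= v) by (unfold v; lra).
  destruct (nfloor_ex v Hv) as [m' Hm'].
  set (m := S m').
  assert (Hm1 : v <= INR m) by (unfold m; rewrite S_INR; lra).
  assert (Hm2 : INR m <= a1 * l).
  { unfold m. rewrite S_INR. apply Rle_trans with (v + 1); [lra|].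
    unfold v, a1.
    assert (E1 : 2 * La <= 2 * La / w1 * l).
    { replace (2 * La) with (2 * La / w1 * w1) at 1 by (field; lra).
      apply Rmult_le_compat_l; [|easy].
      apply Rmult_le_pos; [lra|apply Rlt_le, Rinv_0_lt_compat; lra]. }
    assert (E2 : 1 <= 1 / w1 * l).
    { replace 1 with (1 / w1 * w1) at 1 by (field; lra).
      apply Rmult_le_compat_l; [|easy]. apply Rlt_le, Rdiv_lt_0_compat; lra. }
    lra. }
  assert (Hm3 : 1 <= INR m) by (change 1 with (INR 1); apply le_INR; unfold m; lia).
  assert (H2m : 0 < 2 ^ m) by (apply pow_lt; lra).
  assert (HMm : M / 2 ^ m <= F / 2).
  { apply Rmult_le_reg_r with (2 ^ m); [easy|].
    replace (M / 2 ^ m * 2 ^ m) with M by (field; lra).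
    assert (HM0 : 0 < M) by (apply Rmult_lt_0_compat; [easy|apply exp_pos]).
    assert (HF2 : 0 < F / 2) by lra.
    apply Rnot_lt_le. intros Hlt. apply ln_increasing in Hlt; [|now apply Rmult_lt_0_compat].
    unfold M in Hlt. rewrite !ln_mult, ln_exp, ln_pow in Hlt; try lra; [|apply exp_pos].
    assert (E : ln (2 * d0 / F) = ln d0 - ln (F / 2)).
    { rewrite <- ln_div by lra. f_equal. field. lra. }
    assert (L2 := ln_lt_2). assert (E2 : v * / 2 <= INR m * ln 2).
    { apply Rmult_le_compat; lra. }
    unfold v in E2. lra. }
  set (A := (2 * a1 * b1 + / q) * P + (Rabs c1 + 1)).
  (* If every point of the window fails, f is below exp(-A) on all of [t, t + l], which lies in the
     window because l <= P/q. *)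
  apply NNPP. intros Hno.
  assert (Hseg : forall s, t <= s <= t + l -> Cmod (f (RtoC s)) <= exp (- A)).
  { intros s Hs'. apply Rnot_lt_le. intros Hlt. apply Hno. exists s. split.
    - rewrite Rabs_pos_eq by lra. fold P. nra.
    - fold P. fold A. lra. }
  assert (T := entire_small_on_segment f z0 t l (exp (- A)) M m Hcd Hz0 Hl0 ltac:(unfold m; lia)
    (Rlt_le _ _ (exp_pos _)) Hseg HM).
  cbv zeta in T. fold B eta F in T.
  assert (T2 : F / 2 <= B / eta * (12 * B / l) ^ m * exp (- A)) by lra.
  apply ln_le in T2; [|lra].
  assert (HlB : l <= B) by (unfold B; lra).
  assert (Hy : 1 <= 12 * B / l).
  { apply Rmult_le_reg_r with l; [easy|]. unfold Rdiv. rewrite Rmult_assoc, Rinv_l; lra. }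
  assert (HBe : 0 < B / eta) by now apply Rdiv_lt_0_compat.
  assert (Hyp : 0 < (12 * B / l) ^ m) by (apply pow_lt; lra).
  rewrite ln_mult, ln_exp, ln_mult, ln_pow, (ln_div B) in T2; try lra;
    [|now apply Rmult_lt_0_compat|apply exp_pos].
  set (y := ln (12 * B / l)) in *.
  assert (Hy0 : 0 <= y) by now apply ln_nonneg.
  set (h := ln (1 + tau / l)).
  assert (Hh : q <= h).
  { unfold q, h. assert (0 < / L) by now apply Rinv_0_lt_compat.
    apply ln_le; [lra|]. apply Rplus_le_compat_l.
    apply Rmult_le_reg_r with (L * l); [now apply Rmult_lt_0_compat|].
    replace (/ L * (L * l)) with l by (field; lra).
    replace (tau / l * (L * l)) with (L * tau) by (field; lra). easy. }
  assert (Hyh : y <= b1 * h).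
  { apply Rle_trans with (ln (12 * K) + h).
    - unfold h. assert (0 < tau / l) by (apply Rdiv_lt_0_compat; lra).
      rewrite <- ln_mult by lra. apply ln_le; [lra|].
      apply Rle_trans with (12 * K * (tau / l)); [|nra].
      unfold Rdiv. rewrite <- !Rmult_assoc. apply Rmult_le_compat_r; [|lra].
      apply Rlt_le, Rinv_0_lt_compat; lra.
    - unfold b1. assert (E : ln (12 * K) <= ln (12 * K) / q * h); [|lra].
      replace (ln (12 * K)) with (ln (12 * K) / q * q) at 1 by (field; lra).
      apply Rmult_le_compat_l; [|easy].
      apply Rmult_le_pos; [easy|apply Rlt_le, Rinv_0_lt_compat; lra]. }
  assert (Hmy : INR m * y <= a1 * b1 * P).
  { apply Rle_trans with (a1 * l * (b1 * h)).
    - apply Rmult_le_compat; try easy; lra.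
    - right. unfold P, Pt. fold l. fold h. ring. }
  assert (HlnB : ln B <= y + l).
  { assert (E : ln B <= y + ln l).
    { unfold y. rewrite <- ln_mult by lra. apply ln_le; [easy|].
      replace (12 * B / l * l) with (12 * B) by (field; lra). lra. }
    assert (ln l <= l); [|lra].
    generalize (ln_le_tangent l 1 Hl0 Rlt_0_1). rewrite ln_1. lra. }
  assert (Hyy : y <= INR m * y) by nra.
  assert (Hc1 := Rle_abs c1). unfold A, c1 in *. lra.
Qed.

Lemma majorant_of_growth (r' : nat -> R) (rho : C -> C) (kap C0 : R) :
  log_growth r' (lnabs rho) -> (forall j, 0 <= r' j) ->
  (forall x : R, Cmod (rho (RtoC x)) = exp (lnabs rho x)) ->
  0 < kap -> 0 <= C0 ->
  (forall t, 1 <= t -> kap * Pt (lnabs w) t - C0 <= lnabs rho t) ->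
  minimum_modulus_majorant w rho.
Proof.
  intros HW' Hr' Hexp' Hkap HC0 Hlow.
  set (W := lnabs w) in *. set (V := lnabs rho) in *.
  split.
  (* With this slope ln(1 + 1/eps) >= 1/kap, so kap times [Pt] dominates W itself wherever W(x) <=
     eps x; the remaining bounded range goes into c0. *)
  - set (eps := exp (- / kap)).
    destruct (growth_little_o r W Hr Hr0 HW eps Hdec Hs (exp_pos _)) as [T [HT1 HT]].
    exists (exp (C0 + W T)). split; [apply exp_pos|].
    intros t. rewrite Hexp, Hexp', <- exp_plus. fold (W t) (V t).
    assert (E : W t <= C0 + W T + V t).
    { rewrite <- (growth_abs r W HW t), <- (growth_abs r' V HW' t).
      assert (V0 := growth_nonneg r' V HW' (Rabs t)).
      assert (W0 := growth_nonneg r W HW T).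
      destruct (Rle_dec (Rabs t) T) as [H|H].
      - assert (K := growth_mono r W Hr HW (Rabs t) T (Rabs_pos t) H). lra.
      - apply Rnot_le_lt in H. assert (Hge := Hlow (Rabs t) ltac:(lra)).
        assert (K := Pt_ge_growth r W Hr0 HW (Rabs t) eps ltac:(lra) (exp_pos _) (HT (Rabs t) ltac:(lra))).
        assert (K2 : / kap <= ln (1 + / eps)).
        { unfold eps. rewrite <- exp_Ropp, Ropp_involutive.
          rewrite <- (ln_exp (/ kap)) at 1. apply ln_le; [apply exp_pos|].
          lra. }
        assert (P := growth_nonneg r W HW (Rabs t)).
        assert (K3 : / kap * W (Rabs t) <= Pt W (Rabs t)).
        { eapply Rle_trans; [|apply K]. now apply Rmult_le_compat_r. }
        apply Rmult_le_compat_l with (r := kap) in K3; [|lra].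
        rewrite <- Rmult_assoc, Rinv_r in K3 by lra. lra. }
    destruct E as [E|E]; [left; now apply exp_increasing|rewrite E; lra].
  - intros f Hf Hnz [n0 [d0 [_ [Hd0 Hb]]]].
    destruct (local_lower_bound f n0 d0 Hf Hnz Hd0 Hb) as [a [b [Ha [Hb0 Hab]]]].
    fold W in Hab.
    (* The first term is the additive loss C0 after doubling, for |t| >= 1; the second covers |t| <
       1. *)
    set (D := 4 * C0 / kap + Pt W 2).
    assert (P2 := Pt_nonneg r W Hr0 HW 2 ltac:(lra)).
    assert (HD0 : 0 <= 4 * C0 / kap)
      by (apply Rmult_le_pos; [lra|apply Rlt_le, Rinv_0_lt_compat; lra]).
    assert (Hk4 : 0 < 4 / kap) by (apply Rdiv_lt_0_compat; lra).
    assert (HP : forall t, Pt W (Rabs t + 1) <= 4 / kap * V t + D).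
    { intros t. rewrite <- (growth_abs r' V HW' t). assert (Ht := Rabs_pos t).
      assert (V0 := growth_nonneg r' V HW' (Rabs t)).
      destruct (Rle_dec 1 (Rabs t)) as [H|H].
      - apply Rle_trans with (4 * Pt W (Rabs t)).
        + eapply Rle_trans; [apply (Pt_mono r W Hr Hr0 HW _ (2 * Rabs t)); lra|].
          apply (Pt_double r W Hr0 HW); lra.
        + assert (K := Hlow (Rabs t) H).
          assert (K2 : 4 / kap * (kap * Pt W (Rabs t)) <= 4 / kap * (V (Rabs t) + C0))
            by (apply Rmult_le_compat_l; lra).
          replace (4 / kap * (kap * Pt W (Rabs t))) with (4 * Pt W (Rabs t)) in K2
            by (field; lra).
          unfold D. replace (4 * C0 / kap) with (4 / kap * C0) by (field; lra). lra.
      - apply Rnot_le_lt in H. assert (K := Pt_mono r W Hr Hr0 HW (Rabs t + 1) 2 ltac:(lra) ltac:(lra)).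
        assert (0 <= 4 / kap * V (Rabs t)) by (apply Rmult_le_pos; lra).
        unfold D. lra. }
    assert (HD : 0 <= D) by (unfold D; lra).
    exists (a * (4 / kap)), (a * D + b).
    split; [now apply Rmult_lt_0_compat|]. split; [nra|].
    intros t. destruct (Hab t) as [s [Hs1 Hs2]]. specialize (HP t).
    assert (HP' : a * Pt W (Rabs t + 1) <= a * (4 / kap) * V t + a * D).
    { rewrite Rmult_assoc, <- Rmult_plus_distr_l. apply Rmult_le_compat_l; lra. }
    unfold sup_ln_near.
    apply Rbar_le_trans with (lnE (Cmod (f (RtoC s)))).
    + unfold lnE. assert (Pf : 0 < Cmod (f (RtoC s))).
      { eapply Rlt_le_trans; [apply exp_pos|apply Hs2]. }
      destruct (Rlt_dec 0 (Cmod (f (RtoC s)))) as [_|]; [|easy]. simpl.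
      rewrite <- (ln_exp (- _ * _ - _)). apply ln_le; [apply exp_pos|].
      eapply Rle_trans; [|apply Hs2].
      assert (E : - (a * (4 / kap)) * lnabs rho t - (a * D + b)
        <= - (a * Pt W (Rabs t + 1) + b)) by (fold V; lra).
      destruct E as [E|E]; [left; now apply exp_increasing|rewrite E; lra].
    + apply Rbar_le_lub. exists s. split; [fold V; lra|easy].
Qed.

End Majorant.

(** * Assembling the two cases *)

Lemma growth_ge_partial (r : nat -> R) (W : R -> R) (x y : R) :
  log_growth r W -> (exists n, y <= rsum (fun j => phi (x * r j)) n) -> y <= W x.
Proof. intros H [n Hn]. eapply Rle_trans; [apply Hn|apply H]. Qed.

Lemma majorant_of_sequence (t : nat -> Rbar) (w : C -> C) (s : nat -> R) (kap C0 : R) :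
  Omega_seq t -> is_Omega_product t w ->
  (forall j, 0 < s j) -> ex_series (fun j => / s j) -> 0 < kap -> 0 <= C0 ->
  (forall x, 1 <= x -> exists n,
    kap * Pt (lnabs w) x - C0 <= rsum (fun j => phi (x * / s j)) n) ->
  exists rho, is_Omega_product (fun j => Finite (s j)) rho /\ minimum_modulus_majorant w rho.
Proof.
  intros Ht Hw Hs Hex Hkap HC0 Hlow.
  destruct (Omega_seq_recip t Ht) as [Hr [Hr0 [Hdec Hser]]].
  destruct (Omega_product_growth t w Hw) as [HW Hexp].
  destruct (Omega_product_exists s Hs Hex) as [rho Hrho]. exists rho. split; [easy|].
  destruct (Omega_product_growth _ rho Hrho) as [HV Hexp'].
  apply (majorant_of_growth (fun j => recip (t j)) w Hr Hr0 Hdec Hser HW Hexp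
    (fun j => / s j) rho kap C0); try easy.
  - intros j. now apply Rlt_le, Rinv_0_lt_compat.
  - intros x Hx. apply (growth_ge_partial _ _ _ _ HV). now apply Hlow.
Qed.

Theorem theorem3p8 :
  forall w : C -> C,
    Omega w ->
    mild_strong_nonquasianalytic w ->
    (exists rho : C -> C, Omega rho /\ minimum_modulus_majorant w rho) /\
    (Omega0 w ->
     exists rho : C -> C, Omega0 rho /\ minimum_modulus_majorant w rho).
Proof.
  intros w [t [Ht Hw]] Hmild. split.
  - destruct (Omega_seq_recip t Ht) as [Hr [Hr0 [Hdec Hser]]].
    destruct (Omega_product_growth t w Hw) as [HW Hexp].
    destruct (mild_sum_bound _ w Hr Hr0 Hdec Hser HW Hmild) as [T [K [HT HK]]].
    destruct (Omega_majorant_sequence (Pt (lnabs w))) as [s [Hs1 [Hs2 [Hs3 Hs4]]]].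
    + apply (Pt_nonneg _ _ Hr0 HW).
    + apply (Pt_mono _ _ Hr Hr0 HW).
    + apply (dyadic_sum_bound _ T K); [apply (Pt_nonneg _ _ Hr0 HW)|apply HK].
    + destruct (majorant_of_sequence t w s (/ 4) 0 Ht Hw Hs1 Hs3) as [rho [H1 H2]]; try lra.
      { intros x Hx. destruct (Hs4 x Hx) as [n Hn]. exists n. lra. }
      exists rho. split; [|easy]. exists (fun j => Finite (s j)). split; [|easy].
      repeat split; simpl; auto.
  (* Membership in [Omega0] comes with its own sequence of zeros, so the estimates are redone for
     that one. *)
  - clear t Ht Hw. intros [t [Ht0 Hw]]. assert (Ht := proj1 Ht0).
    destruct (Omega_seq_recip t Ht) as [Hr [Hr0 [Hdec Hser]]].
    destruct (Omega_product_growth t w Hw) as [HW Hexp].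
    destruct (mild_sum_bound _ w Hr Hr0 Hdec Hser HW Hmild) as [T [K [HT HK]]].
    destruct (Omega0_majorant_sequence _ _ Hr Hr0 HW (fun j => Omega0_seq_recip t j Ht0) T K HK)
      as [s [Hs1 [Hs2 [Hs3 Hs4]]]].
    assert (HC := slope_const_ge_1 _ _ Hr0 HW).
    destruct (majorant_of_sequence t w s (/ (16 * slope_const (lnabs w))) (/ 4) Ht Hw Hs1 Hs3)
      as [rho [H1 H2]]; try lra; [apply Rinv_0_lt_compat; lra|easy|].
    exists rho. split; [|easy]. exists (fun j => Finite (s j)). split; [|easy].
    (* Nondecreasing ratios s_j/(j + 1) of positive numbers force s to increase. *)
    assert (Hinc : forall j, s j <= s (S j)).
    { intros j. specialize (Hs2 j). specialize (Hs1 j).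
      assert (P1 : 0 < INR (S j)) by (apply lt_0_INR; lia). assert (P2 := S_INR (S j)).
      apply Rmult_le_compat_r with (r := INR (S (S j))) in Hs2; [|lra].
      replace (s (S j) / INR (S (S j)) * INR (S (S j))) with (s (S j)) in Hs2 by (field; lra).
      eapply Rle_trans; [|apply Hs2].
      replace (s j / INR (S j) * INR (S (S j))) with (s j + s j / INR (S j))
        by (rewrite P2; field; lra).
      assert (0 < s j / INR (S j)) by now apply Rdiv_lt_0_compat. lra. }
    split; [repeat split; simpl; auto|]. exact Hs2.
Qed.
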